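(* Let $G$ be a Laman graph. If $G$ is not $\triangle$-connected, then either $G$ has a NAC-coloring, or there exists a problematic graph $\widetilde G$ which has no NAC-coloring such that $G$ can be constructed from $\widetilde G$ by a (possibly empty) sequence of Henneberg moves (possibly $G=\widetilde G$).
   Context: Graphs are finite, simple, undirected. A graph $G$ is a Laman graph if $|E_G|=2|V_G|-3$ and every subgraph $H$ with at least two vertices satisfies $|E_H|\le 2|V_H|-3$. For a graph $G$, let $\sim'$ be the relation on $E_G$ with $e_1\sim' e_2$ iff some triangle subgraph contains both, and $\sim$ its reflexive-transitive closure; $G$ is $\triangle$-connected if $e_1\sim e_2$ for all $e_1,e_2\in E_G$. A coloring $\delta\colon E_G\to\{\text{blue},\text{red}\}$ is a NAC-coloring if it is surjective and $G$ has no cycle with exactly one blue edge and no cycle with exactly one red edge. Henneberg moves: from a graph $G'=(V',E')$ and a new vertex $v\notin V'$, a move of type I from distinct $u,u'\in V'$ gives $V_G=V'\cup\{v\}$, $E_G=E'\cup\{uv,u'v\}$; a move of type II from distinct $u,u_1,u_2\in V'$ with $u_1u_2\in E'$ gives $V_G=V'\cup\{v\}$, $E_G=(E'\setminus\{u_1u_2\})\cup\{uv,u_1v,u_2v\}$. ''$G$ can be constructed from $\widetilde G$ by Henneberg moves'' means there is a sequence of Laman graphs $\widetilde G=G_k,G_{k+1},\dots,G_n=G$ with each $G_{i}$ obtained from $G_{i-1}$ by a Henneberg move of type I or II. A Laman graph $\widetilde G$ is problematic if: (1) every vertex has degree at least $3$; (2) for every vertex $v$ of degree $3$, exactly two of the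 neighbors of $v$ are joined by an edge and both of these have degree at least $4$; (3) every vertex lies in some triangle (subgraph isomorphic to $C_3$). *)

(* Defs.v *)
From mathcomp Require Import all_boot.

Set Implicit Arguments.
Unset Strict Implicit.
Unset Printing Implicit Defensive.

(* A graph whose vertices form a subset of an ambient finite type, so that
   subgraphs and Henneberg extensions are literal set inclusions; an edge is
   the two-element set of its ends. *)
Record graph (T : finType) := Graph {
  vertices : {set T};
  edges : {set {set T}};
  edgesP : [forall e in edges, (e \subset vertices) && (#|e| == 2)] }.

Section Graphs.
Variable T : finType.
Implicit Types (G H : graph T) (x y z u v : T) (e : {set T}).

Definition adj G : rel T := fun x y => [set x; y] \in edges G.

Definition neighbors G x : {set T} := [set y | adj G x y].

Definition degree G x : nat := #|neighbors G x|.

Definition subgraph H G : bool :=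
  (vertices H \subset vertices G) && (edges H \subset edges G).

(* Stated additively: truncated subtraction would make the one-vertex graph
   a Laman graph. *)
Definition laman G : Prop :=
  #|edges G| + 3 = 2 * #|vertices G| /\
  forall H, subgraph H G -> 1 < #|vertices H| ->
    #|edges H| + 3 <= 2 * #|vertices H|.

(* The three vertices are automatically distinct, edges having two elements. *)
Definition triangle G x y z : bool := [&& adj G x y, adj G y z & adj G x z].

Definition triangle_edges x y z : {set {set T}} :=
  [set [set x; y]; [set y; z]; [set x; z]].

Definition in_triangle G : rel {set T} := fun e1 e2 =>
  [exists x, exists y, exists z, triangle G x y z &&
    ((e1 \in triangle_edges x y z) && (e2 \in triangle_edges x y z))].

Definition triangle_connected G : Prop :=
  forall e1 e2, e1 \in edges G -> e2 \in edges G ->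
    connect (in_triangle G) e1 e2.

Definition graph_cycle G (c : seq T) : bool :=
  [&& 2 < size c, uniq c & cycle (adj G) c].

Definition cycle_edges (c : seq T) : seq {set T} :=
  [seq [set x; next c x] | x <- c].

(* The two colors are the booleans; only the values of delta on the edges of G
   are relevant. *)
Definition nac_coloring G (delta : {set T} -> bool) : Prop :=
  (forall col : bool, exists2 e, e \in edges G & delta e = col) /\
  (forall (col : bool) (c : seq T), graph_cycle G c ->
     count (fun e => delta e == col) (cycle_edges c) <> 1).

Definition has_nac_coloring G : Prop := exists delta, nac_coloring G delta.

Definition henneberg1 G' G : Prop :=
  exists v u u',
    [/\ v \notin vertices G',
        [/\ u \in vertices G', u' \in vertices G' & u != u'],
        vertices G = v |: vertices G'
      & edges G = edges G' :|: [set [set u; v]; [set u'; v]]].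

Definition henneberg2 G' G : Prop :=
  exists v u u1 u2,
    [/\ v \notin vertices G',
        [/\ u \in vertices G', u1 \in vertices G' & u2 \in vertices G'],
        [/\ u != u1, u != u2, u1 != u2 & [set u1; u2] \in edges G'],
        vertices G = v |: vertices G'
      & edges G = (edges G' :\ [set u1; u2])
                    :|: [set [set u; v]; [set u1; v]; [set u2; v]]].

Inductive henneberg_constructible G0 : graph T -> Prop :=
| Henneberg_nil : laman G0 -> henneberg_constructible G0 G0
| Henneberg_rcons G' G :
    henneberg_constructible G0 G' -> henneberg1 G' G \/ henneberg2 G' G ->
    laman G -> henneberg_constructible G0 G.

(* In the degree-three clause, {u1, u2} is the only edge of G between two
   neighbors of v. *)
Definition problematic G : Prop :=
  [/\ laman G,
      forall v, v \in vertices G -> 3 <= degree G v,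
      forall v, v \in vertices G -> degree G v = 3 ->
        exists u1 u2,
          [/\ [set e in edges G | e \subset neighbors G v] = [set [set u1; u2]],
              4 <= degree G u1 & 4 <= degree G u2]
    & forall v, v \in vertices G -> exists x y, triangle G v x y].

End Graphs.

(* Main.v *)
(* A NAC-coloring is the same thing as a map (f, g) of the vertices to a grid
   that sends every edge to a horizontal or vertical segment of nonzero length,
   with both directions occurring; in this form colorings are easy to extend.

   The theorem is proved by induction on the number of vertices.  A vertex in
   no triangle gives a coloring at once (one color for its edges).  A vertex of
   degree 2 in a triangle is removed.  A vertex v of degree 3 whose neighbors
   c, p, q span cp and cq is removed and replaced by the edge pq.  If two
   adjacent vertices v, w of degree 3 have a common neighbor y, and the third
   neighbors u of v and a of w are adjacent, then v and w are removed and one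
   of the edges uy, ay is added.  If none of this applies, the graph is
   problematic.  The grid map of the smaller graph extends to the original
   one.  If the smaller graph is triangle-connected, the induction hypothesis
   is not available, but then every edge other than the new edge pq lies in a
   tight set (2n - 3 edges on n vertices) of the graph without pq that contains
   p or q and a common neighbor of p and q.  Two such sets meet only in p, q or
   their common neighbor, and a coloring can be written down from them. *)

Require Import Defs.
From mathcomp Require Import all_boot zify.
From Stdlib Require Import Classical.

Set Implicit Arguments.
Unset Strict Implicit.
Unset Printing Implicit Defensive.

(** * Counting edges *)

Section EdgeCounts.
Variable T : finType.
Implicit Types (G H K : graph T) (x y z u v w p q : T) (e : {set T}).
Implicit Types (X Y A : {set T}).

Lemma eq_set2 x y p q :
  ([set x; y] == [set p; q]) = (x == p) && (y == q) || (x == q) && (y == p).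
Proof.
apply/eqP/idP => [/setP E|].
  have := (E x, E y, E p, E q); rewrite !inE !eqxx !orbT /=.
  rewrite (eq_sym p x) (eq_sym p y) (eq_sym q x) (eq_sym q y).
  by case: (x == p); case: (x == q); case: (y == p); case: (y == q) => // -[[[]]].
by case/orP=> /andP[/eqP-> /eqP->] //; rewrite setUC.
Qed.

Lemma adj_sym G : symmetric (adj G).
Proof. by move=> x y; rewrite /adj setUC. Qed.

Lemma edge_proper G e : e \in edges G -> (e \subset vertices G) && (#|e| == 2).
Proof. by move/(forall_inP (edgesP G)). Qed.

Lemma adj_neq G x y : adj G x y -> x != y.
Proof. by move/edge_proper=> /andP[_]; rewrite cards2; case: (x == y). Qed.

Lemma adj_irr G x : adj G x x = false.
Proof. by apply/negP=> /adj_neq; rewrite eqxx. Qed.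

Lemma adj_vertex G x y : adj G x y -> x \in vertices G.
Proof. by move=> /edge_proper/andP[/subsetP s _]; rewrite s ?inE ?eqxx. Qed.

Lemma edge_adj G e : e \in edges G -> exists x y, e = [set x; y] /\ adj G x y.
Proof.
move=> eG; have /andP[_ /cards2P[x [y [xy E]]]] := edge_proper eG.
by exists x, y; rewrite /adj -E.
Qed.

Lemma edge_at G e x : e \in edges G -> x \in e ->
  exists2 y, e = [set x; y] & adj G x y.
Proof.
move=> /edge_adj [y [z [-> a]]]; rewrite !inE => /orP[]/eqP->; first by exists z.
by exists y; rewrite 1?setUC // adj_sym.
Qed.

Lemma in_neighbors G x y : (y \in neighbors G x) = adj G x y.
Proof. by rewrite inE. Qed.

Fact mkgraph_proper (V : {set T}) (E : {set {set T}}) :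
  [forall e in [set e in E | (e \subset V) && (#|e| == 2)],
     (e \subset V) && (#|e| == 2)].
Proof. by apply/forall_inP=> e; rewrite !inE => /andP[]. Qed.

(** The filter makes this total: any [V] and [E] give a graph. In [remove] it discards exactly the
    edges at the deleted vertex. *)
Definition mkgraph V E : graph T := Graph (mkgraph_proper V E).

Definition remove G v := mkgraph (vertices G :\ v) (edges G).

Definition add_edge G p q := mkgraph (vertices G) ([set p; q] |: edges G).

Lemma adj_remove G v x y :
  adj (remove G v) x y = [&& adj G x y, x != v & y != v].
Proof.
rewrite /adj !inE; apply/idP/idP => [/andP[xy /andP[/subsetP s _]]|/and3P[xy xv yv]].
  rewrite xy; have := s x; have := s y.
  by rewrite !inE !eqxx orbT => /(_ isT)/andP[-> _] /(_ isT)/andP[-> _].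
have /andP[/subsetP s ->] := edge_proper xy; rewrite xy andbT /=.
apply/subsetP=> z zxy; rewrite !inE (s z zxy) andbT.
by move: zxy; rewrite !inE => /orP[]/eqP->.
Qed.

Lemma adj_add_edge G p q x y : p \in vertices G -> q \in vertices G -> p != q ->
  adj (add_edge G p q) x y = adj G x y || ([set x; y] == [set p; q]).
Proof.
move=> pG qG pq; rewrite /adj !inE orbC.
case E: ([set x; y] == _) => /=.
  rewrite orbT (eqP E) cards2 pq andbT.
  by apply/subsetP=> z; rewrite !inE => /orP[]/eqP->.
by rewrite !orbF; case xy: (_ \in _) => //=; exact: edge_proper.
Qed.

Definition inside G X : {set {set T}} := [set e in edges G | e \subset X].

Definition size_in G X : nat := #|inside G X|.

(** [X] ranges over all subsets of the ambient type, so unions and intersections can be used without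
    checking that they consist of vertices of [G]. *)
Definition sparse G : Prop :=
  forall X, 1 < #|X| -> size_in G X + 3 <= 2 * #|X|.

(** An edge inside [X] or inside [Y] is inside the union, and an edge inside both is inside the
    intersection. Edges joining the two differences count only on the right. *)
Lemma size_in_supermodular G X Y :
  size_in G X + size_in G Y <=
  size_in G (X :|: Y) + size_in G (X :&: Y).
Proof.
rewrite /size_in -cardsUI; apply: leq_add; apply: subset_leq_card; apply/subsetP=> e.
  rewrite !inE => /orP[]/andP[-> /subset_trans-> //]; first exact: subsetUl.
  exact: subsetUr.
by rewrite !inE subsetI => /andP[/andP[-> ->] /andP[_ ->]].
Qed.

Lemma inside_vertices G X : vertices G \subset X -> inside G X = edges G.
Proof.
move=> s; apply/setP=> e; rewrite inE; case eG: (_ \in _) => //=.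
by have /andP[/subset_trans-> //] := edge_proper eG.
Qed.

Lemma size_inU1 G v X : v \notin X ->
  size_in G (v |: X) = size_in G X + #|neighbors G v :&: X|.
Proof.
move=> vX; pose S := [set [set v; y] | y in neighbors G v :&: X].
have cS : #|S| = #|neighbors G v :&: X|.
  apply: card_in_imset => y z; rewrite !inE => /andP[a _] /andP[b _] /eqP.
  rewrite eq_set2 eqxx => /orP[/eqP //|/andP[/eqP vz /eqP yv]].
  by rewrite -vz yv.
rewrite /size_in -cS -cardsUI addnC.
have -> : inside G X :&: S = set0.
  apply/setP=> e; rewrite !inE; apply/negP=> /andP[/andP[_ /subsetP s] /imsetP[y _ E]].
  by move/negP: vX; apply; apply: s; rewrite E !inE eqxx.
rewrite cards0 add0n; congr #|pred_of_set _|; apply/setP=> e; rewrite !inE.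
apply/idP/idP.
  move=> /andP[eG /subsetP s]; rewrite eG /=; case ve: (v \in e); last first.
    apply/orP; left; apply/subsetP=> z ze.
    by have := s z ze; rewrite !inE; case: eqP => // zv; rewrite -zv ze in ve.
  have [y E a] := edge_at eG ve; apply/orP; right; apply/imsetP; exists y => //.
  rewrite !inE a /=; have := s y; rewrite E !inE eqxx orbT => /(_ isT).
  by rewrite eq_sym (negPf (adj_neq a)).
case/orP=> [/andP[-> /subset_trans-> //]|]; first exact: subsetUr.
case/imsetP=> y; rewrite !inE => /andP[a yX] ->; rewrite [_ \in _]a /=.
by apply/subsetP=> z; rewrite !inE => /orP[]/eqP->; rewrite ?eqxx ?yX ?orbT.
Qed.

Lemma size_in_le1 G X : #|X| <= 1 -> size_in G X = 0.
Proof.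
move=> X1; apply/eqP; rewrite /size_in cards_eq0; apply/eqP/setP=> e; rewrite !inE.
apply/negP=> /andP[/edge_proper/andP[_ /eqP e2] /subset_leq_card]; lia.
Qed.

Lemma size_in_remove G v X :
  v \notin X -> size_in (remove G v) X = size_in G X.
Proof.
move=> vX; congr #|pred_of_set _|; apply/setP=> e; rewrite !inE; case eG: (_ \in _) => //=.
have /andP[s ->] := edge_proper eG; rewrite andbT.
case eX: (e \subset X); rewrite ?andbF // andbT subsetD1 s /=.
by apply/negP=> /(subsetP eX); rewrite (negPf vX).
Qed.

Lemma size_in_add_edge G p q X : p \in vertices G -> q \in vertices G ->
  p != q -> ~~ adj G p q ->
  size_in (add_edge G p q) X = size_in G X + ((p \in X) && (q \in X)).
Proof.
move=> pG qG pq npq.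
have npqX : [set p; q] \notin inside G X by rewrite inE negb_and [_ \notin _]npq.
have sX : ([set p; q] \subset X) = (p \in X) && (q \in X).
  by rewrite subUset !sub1set.
have iE : inside (add_edge G p q) X =
    if [set p; q] \subset X then [set p; q] |: inside G X else inside G X.
  apply/setP=> e; have eE : (e \in edges (add_edge G p q)) =
      (e == [set p; q]) || (e \in edges G).
    rewrite !inE; case: eqP => [->|_] /=.
      rewrite cards2 pq andbT; apply/subsetP=> z.
      by rewrite !inE => /orP[]/eqP->.
    by case eG: (_ \in _) => //=; exact: edge_proper.
  rewrite inE eE; case: ifP => s; rewrite !inE.
    by case: eqP => [->|].
  by case: eqP => [->|]; rewrite // s !andbF.
rewrite /size_in -sX iE; case: ifP => _; last by rewrite addn0.
by rewrite cardsU1 npqX addnC.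
Qed.

(** Points of [X] that are not vertices carry no edges, so the bound for [X :&: vertices G]
    suffices. If fewer than two vertices remain, there are no edges at all and [1 < #|X|] gives the
    bound. *)
Lemma laman_sparse G : laman G -> sparse G.
Proof.
move=> [_ l] X X1; pose Y := X :&: vertices G.
have iE : inside G X = inside G Y.
  apply/setP=> e; rewrite !inE; case eG: (_ \in _) => //=.
  by have /andP[s _] := edge_proper eG; rewrite subsetI s andbT.
have YX : #|Y| <= #|X| by apply/subset_leq_card/subsetIl.
have [Y1|Y1] := leqP #|Y| 1; first by rewrite /size_in iE -/(size_in G Y) size_in_le1 //; lia.
have sH : subgraph (mkgraph Y (edges G)) G.
  rewrite /subgraph /= subsetIr; apply/subsetP=> e.
  by rewrite inE => /andP[].
have := l (mkgraph Y (edges G)).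
have -> : edges (mkgraph Y (edges G)) = inside G Y.
  apply/setP=> e; rewrite !inE; case eG: (_ \in _) => //=.
  by have /andP[_ ->] := edge_proper eG; rewrite andbT.
by move/(_ sH Y1); rewrite /size_in iE /=; lia.
Qed.

(** Among the subgraphs on a given vertex set the induced one has the most edges, so it is enough to
    bound [size_in]. *)
Lemma sparse_laman G :
  size_in G (vertices G) + 3 = 2 * #|vertices G| ->
  (forall X, X \subset vertices G -> 1 < #|X| -> size_in G X + 3 <= 2 * #|X|) ->
  laman G.
Proof.
rewrite /size_in inside_vertices // => cE s; split=> // H /andP[sV sE] V1.
apply: leq_trans (s _ sV V1); rewrite leq_add2r; apply: subset_leq_card.
apply/subsetP=> e eH; rewrite inE (subsetP sE) //=.
by have /andP[] := edge_proper eH.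
Qed.

Lemma laman_size G : laman G -> size_in G (vertices G) + 3 = 2 * #|vertices G|.
Proof. by case=> <- _; rewrite /size_in inside_vertices. Qed.

(** If at most one edge were lost with [x], the remaining vertices, of which there are at least two,
    would span more edges than sparsity allows. *)
Lemma laman_degree G x : laman G -> 2 < #|vertices G| -> x \in vertices G ->
  2 <= degree G x.
Proof.
move=> lG V2 xG; have := laman_size lG.
rewrite -(setD1K xG) size_inU1 ?setD11 // cardsU1 setD11 /=.
have V1 : 1 < #|vertices G :\ x| by move: V2; rewrite (cardsD1 x) xG; lia.
have := laman_sparse lG V1.
have : #|neighbors G x :&: (vertices G :\ x)| <= degree G x.
  by apply/subset_leq_card/subsetIl.
lia.
Qed.

Lemma neighborsI G x : neighbors G x :&: (vertices G :\ x) = neighbors G x.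
Proof.
apply/setIidPl/subsetP=> y; rewrite !inE => a.
by rewrite (adj_vertex (y := x)) 1?adj_sym // eq_sym (adj_neq a).
Qed.

Lemma laman_remove2 G v : laman G -> v \in vertices G -> degree G v = 2 ->
  laman (remove G v).
Proof.
move=> lG vG dv; apply: sparse_laman => [|X].
  rewrite /= size_in_remove ?setD11 //; have := laman_size lG.
  rewrite -{1 2}(setD1K vG) size_inU1 ?setD11 // neighborsI -/(degree G v) dv.
  by rewrite cardsU1 setD11 /=; lia.
rewrite /= subsetD1 => /andP[_ vX] X1; rewrite size_in_remove //.
exact: laman_sparse.
Qed.

(** This inverts a move of type II. Three edges at [v] are traded for [pq], which keeps the total
    right; the last hypothesis leaves room for one more edge in every set that contains both [p] and
    [q]. *)
Lemma laman_move G v p q : laman G -> v \in vertices G -> degree G v = 3 ->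
  adj G v p -> adj G v q -> p != q -> ~~ adj G p q ->
  (forall X, v \notin X -> p \in X -> q \in X -> size_in G X + 4 <= 2 * #|X|) ->
  laman (add_edge (remove G v) p q).
Proof.
move=> lG vG dv vp vq pq npq s.
have pG : p \in vertices (remove G v).
  by rewrite !inE (adj_vertex (y := v)) 1?adj_sym // eq_sym (adj_neq vp).
have qG : q \in vertices (remove G v).
  by rewrite !inE (adj_vertex (y := v)) 1?adj_sym // eq_sym (adj_neq vq).
have npq' : ~~ adj (remove G v) p q by rewrite adj_remove (negPf npq).
apply: sparse_laman => [|X].
  rewrite size_in_add_edge // pG qG /= size_in_remove ?setD11 //.
  have := laman_size lG.
  rewrite -{1 2}(setD1K vG) size_inU1 ?setD11 // neighborsI -/(degree G v) dv.
  by rewrite cardsU1 setD11 /=; lia.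
rewrite /= subsetD1 => /andP[_ vX] X1.
rewrite size_in_add_edge // size_in_remove //.
have := laman_sparse lG X1.
by case: andP => [[pX qX]|_] /=; [have := s X vX pX qX|]; lia.
Qed.

End EdgeCounts.

(** * NAC-colorings as maps to a grid *)

Section GridMaps.
Variable T : finType.
Implicit Types (G H K : graph T) (x y z u v w p q : T) (e : {set T}).
Implicit Types (X Y A : {set T}).

(* [next c] permutes [c]; if [x] were the only place where [h] changes, the
   preimage of the class of [x] would be this class with [x] removed. *)
Lemma count_change_neq1 (S : eqType) (h : T -> S) (c : seq T) : uniq c ->
  count (fun x => h x != h (next c x)) c <> 1.
Proof.
move=> uc E.
have /hasP[x xc hx] : has (fun x => h x != h (next c x)) c by rewrite has_count E.
have only y : y \in c -> y != x -> h y = h (next c y).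
  move=> yc yx; apply/eqP/negP=> /negP hy; move: E.
  rewrite (permP (perm_to_rem xc)) /= hx.
  have : has (fun x => h x != h (next c x)) (rem x c).
    by apply/hasP; exists y; rewrite // mem_rem_uniq // !inE yx.
  by rewrite has_count; lia.
have pc : perm_eq (map (next c) c) c.
  apply: uniq_perm => //.
    by rewrite map_inj_in_uniq // => y z _ _; exact: (can_inj (prev_next uc)).
  move=> y; apply/mapP/idP => [[z zc ->]|yc]; first by rewrite mem_next.
  by exists (prev c y); rewrite ?mem_prev // next_prev.
pose k := count (fun y => h y == h x) c.
have kE : k = count (fun y => h (next c y) == h x) c.
  by rewrite /k -(permP pc) count_map.
have : count (predU (fun y => h (next c y) == h x) (pred1 x)) c <= k.
  rewrite /k (eq_in_count (a2 := predI (predU (fun y => h (next c y) == h x)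
    (pred1 x)) (mem c))) => [|y yc /=]; last by rewrite yc andbT.
  apply: sub_count => y /= /andP[/orP[|/eqP-> //] + yc].
  by case: (eqVneq y x) => [->//|yx]; rewrite -only.
have := count_predUI (fun y => h (next c y) == h x) (pred1 x) c.
have -> : count (predI (fun y => h (next c y) == h x) (pred1 x)) c = 0.
  apply/eqP; rewrite -leqn0 leqNgt -has_count; apply/hasPn=> y yc /=.
  by rewrite andbC; case: eqP => //= ->; rewrite eq_sym.
have := count_uniq_mem x uc; rewrite xc -kE => ->.
by rewrite addn0 => ->; rewrite addn1 ltnn.
Qed.

(** The coordinate types are arbitrary so that [option T] can be used, with [None] as an extra
    position. *)
Definition on_grid G (A B : eqType) (f : T -> A) (g : T -> B) : Prop :=
  [/\ forall x y, adj G x y -> (f x == f y) = (g x != g y),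
      exists x y, adj G x y /\ f x = f y
    & exists x y, adj G x y /\ g x = g y].

(** An edge is colored by whether [f] agrees at its ends. Around a cycle, one color marks the places
    where [g] changes and the other one those where [f] changes, and no function changes exactly
    once around a cycle. *)
Lemma on_grid_nac G (A B : eqType) (f : T -> A) (g : T -> B) :
  on_grid G f g -> has_nac_coloring G.
Proof.
case=> fg [x1 [y1 [a1 e1]]] [x2 [y2 [a2 e2]]].
pose d e := [forall x in e, forall y in e, f x == f y].
have dE x y : d [set x; y] = (f x == f y).
  apply/forall_inP/eqP => [h|h z zxy].
    by have /forall_inP/(_ y) := h x (set21 x y); rewrite set22 => /(_ isT)/eqP.
  apply/forall_inP=> t; move: zxy; rewrite !inE => /orP[] /eqP-> /orP[] /eqP-> //;
  by rewrite h.
exists d; split.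
  case; [exists [set x1; y1] | exists [set x2; y2]] => //; rewrite dE.
    by apply/eqP.
  by rewrite fg // e2 eqxx.
move=> col c /and3P[_ uc cc]; rewrite /cycle_edges count_map.
case: col.
  rewrite (eq_in_count (a2 := fun x => g x != g (next c x))).
    exact: count_change_neq1.
  by move=> x xc /=; rewrite dE eqb_id fg // next_cycle.
rewrite (eq_in_count (a2 := fun x => f x != f (next c x))).
  exact: count_change_neq1.
by move=> x xc /=; rewrite dE eqbF_neg.
Qed.

(** The two coordinates of a vertex are its components in the two one-colored subgraphs, represented
    by their roots. *)
Lemma nac_on_grid G : has_nac_coloring G ->
  exists f g : T -> T, on_grid G f g.
Proof.
case=> d [surj cyc].
pose r (c : bool) : rel T := fun x y => adj G x y && (d [set x; y] == c).
have rsym c : connect_sym (r c).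
  by apply: sym_connect_sym => x y; rewrite /r adj_sym setUC.
(* A path in the other color between the ends of an edge of color [c] would close up to a cycle with
   exactly one edge of color [c]. *)
have nr c x y : adj G x y -> d [set x; y] = c -> connect (r (~~ c)) x y = false.
  move=> a dxy; apply/negP=> /connectP[p0 p0P yE].
  case/shortenP: p0P yE => p pP up _ yE.
  case/lastP: p => [|p z] in pP up yE; first by rewrite /= in yE; rewrite yE adj_irr in a.
  rewrite last_rcons in yE; subst z.
  (* The path is not the edge [xy] itself, which has the wrong color, so the cycle has at least
     three vertices. *)
  have p_nil : 0 < size p.
    case: p pP {up} => //=; rewrite andbT /r dxy andbC.
    by case: (c).
  pose C := y :: x :: p.
  have uC : uniq C.
    move: up; rewrite /= rcons_uniq mem_rcons !inE !negb_or.
    by case/and3P=> /andP[xy ->] -> ->; rewrite eq_sym xy.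
  have Cn : next C y = x by rewrite /= eqxx.
  (* Every step is allowed at [y], where the cycle closes; so [next_cycle] still yields the color of
     each of the other edges. *)
  pose e : rel T := fun z z' => r (~~ c) z z' || (z == y).
  have eC : cycle e C.
    rewrite /= {1}/e eqxx orbT /=; apply: sub_path pP.
    by move=> s t; rewrite /e => ->.
  have gC : graph_cycle G C.
    rewrite /graph_cycle uC /= !ltnS p_nil adj_sym a /=.
    by apply: sub_path pP => s t /andP[].
  have dC z : z \in C -> (d [set z; next C z] == c) = (z == y).
    move=> zC; case: (eqVneq z y) => [->|zy]; first by rewrite Cn setUC dxy eqxx.
    have := next_cycle eC zC; rewrite /e (negPf zy) orbF => /andP[_ /eqP ->].
    by case: (c).
  apply: (cyc c C gC); rewrite /cycle_edges count_map.
  by rewrite (eq_in_count (a2 := pred1 y)) // count_uniq_mem // mem_head.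
have rt x y : adj G x y ->
    (root (r true) x == root (r true) y) = (d [set x; y]) /\
    (root (r false) x == root (r false) y) = ~~ (d [set x; y]).
  move=> a; rewrite !root_connect //; case E: (d _); split.
  - by apply: connect1; rewrite /r a E.
  - exact: (nr true).
  - exact: (nr false).
  - by apply: connect1; rewrite /r a E.
exists (root (r true)), (root (r false)); split=> [x y a| |].
- by have [-> ->] := rt x y a; rewrite negbK.
- have [e eG de] := surj true; have [x [y [E a]]] := edge_adj eG.
  by exists x, y; split=> //; apply/eqP; rewrite (rt x y a).1 -E de.
- have [e eG de] := surj false; have [x [y [E a]]] := edge_adj eG.
  by exists x, y; split=> //; apply/eqP; rewrite (rt x y a).2 -E de.
Qed.

(* One color for the edges that meet [A], the other one for the remaining edges. *)
Lemma cut_nac G A :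
  (forall x y, adj G x y -> x \notin A -> y \notin A ->
     (exists2 a, a \in A & adj G a x) -> (exists2 b, b \in A & adj G b y) -> False) ->
  (exists x y, adj G x y /\ x \in A) ->
  (exists x y, [/\ adj G x y, x \notin A & y \notin A]) ->
  has_nac_coloring G.
Proof.
move=> ind [x1 [y1 [a1 x1A]]] [x2 [y2 [a2 x2A y2A]]].
pose near x := (x \in A) || [exists a in A, adj G a x].
have nearP x : x \notin A -> near x -> exists2 a, a \in A & adj G a x.
  by move=> /negPf xA; rewrite /near xA => /exists_inP.
(* [f] contracts the complement of [A], and [g] contracts [A] together with its neighbors. By [ind],
   no edge outside [A] has both ends contracted by [g]. *)
pose f x := if x \in A then Some x else None.
pose g x := if near x then None else Some x.
have nA x y : adj G x y -> x \in A -> near x && near y.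
  move=> a xA; rewrite /near xA /=; apply/orP; right; apply/exists_inP.
  by exists x.
apply: (@on_grid_nac _ _ _ f g); split.
- move=> x y a; rewrite /f /g.
  have xy := adj_neq a; have xy' : (Some x == Some y) = false by apply/negbTE.
  case xA: (x \in A).
    have /andP[-> ->] := nA _ _ a xA; case: (y \in A) => //.
  case yA: (y \in A).
    by have /andP[-> ->] := nA y x (etrans (adj_sym _ _ _) a) yA.
  case nx: (near x); case ny: (near y) => //.
    by have := ind _ _ a (negbT xA) (negbT yA) (nearP _ (negbT xA) nx) (nearP _ (negbT yA) ny).
- by exists x2, y2; split; rewrite /f ?(negPf x2A) ?(negPf y2A).
- by exists x1, y1; split; rewrite /g //; have /andP[-> ->] := nA _ _ a1 x1A.
Qed.

(* The new vertex [v] is put on the line through the images of [p] and [q], at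
   an unused position. *)
Lemma extend_nac G K v p q (phi : T -> T) :
  has_nac_coloring K -> adj K p q ->
  (forall x y, adj G x y -> x != v -> y != v -> adj K (phi x) (phi y)) ->
  (forall x, adj G v x ->
     [|| phi x == p, phi x == q | adj K (phi x) p && adj K (phi x) q]) ->
  (forall x y, adj K x y -> [set x; y] != [set p; q] ->
     [/\ adj G x y, x != v, y != v, phi x = x & phi y = y]) ->
  (exists x, adj G v x) ->
  has_nac_coloring G.
Proof.
move=> /nac_on_grid[f [g fgK]] apq GK vpq KG [x0 vx0].
(* Exactly one coordinate agrees at [p] and [q]; exchanging the coordinates makes it [f]. *)
wlog pqE : f g fgK / f p = f q.
  move=> wl; have [fg e1 e2] := fgK.
  case: (eqVneq (f p) (f q)) => [|npq]; first exact: wl fgK.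
  apply: (wl g f); last by apply/eqP; apply: contraNT npq; rewrite fg.
  by split=> // x y /fg->; rewrite negbK.
case: fgK => fg [x1 [y1 [a1 e1]]] [x2 [y2 [a2 e2]]].
pose f' x := if x == v then f p else f (phi x).
pose g' x := if x == v then None else Some (g (phi x)).
(* A triangle has only one color, so a common neighbor of [p] and [q] lies on the line through
   them. *)
have fv x : adj G v x -> f (phi x) = f p.
  case/vpq/or3P=> [/eqP->|/eqP->|/andP[xp xq]] //.
  apply/eqP; case E: (f (phi x) == f p) => //.
  have := fg _ _ apq; have := fg _ _ xq; have := fg _ _ xp.
  rewrite -pqE E eqxx => /esym/negbFE/eqP-> /esym/negbFE/eqP->.
  by rewrite eqxx.
apply: (@on_grid_nac _ _ _ f' g'); split.
- move=> x y a; rewrite /f' /g'; case: (eqVneq x v) => [xv|xv].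
    subst x; rewrite [y == v]eq_sym (negPf (adj_neq a)).
    by rewrite fv // eqxx.
  case: (eqVneq y v) => [yv|yv]; last exact: fg (GK _ _ a xv yv).
  by subst y; rewrite fv ?eqxx // adj_sym.
- exists v, x0; split=> //; rewrite /f' eqxx eq_sym (negPf (adj_neq vx0)).
  by rewrite fv.
(* The edge on which [g] agrees cannot be [pq], on which [f] agrees, so it survives in [G]. *)
- have npq : [set x2; y2] != [set p; q].
    apply/eqP=> /eqP; rewrite eq_set2.
    have := fg _ _ apq; rewrite pqE eqxx => gpq.
    by case/orP=> /andP[/eqP E /eqP E']; subst; rewrite e2 eqxx in gpq.
  have [a xv yv px py] := KG _ _ a2 npq; exists x2, y2; split=> //.
  by rewrite /g' (negPf xv) (negPf yv) px py e2.
Qed.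
End GridMaps.

(** * Tight sets *)

Section TightSets.
Variable T : finType.
Implicit Types (G H K : graph T) (x y z u v w p q : T) (e : {set T}).
Implicit Types (X Y A : {set T}).

Lemma in_triangleP G e1 e2 : reflect
  (exists x y z, [/\ triangle G x y z, e1 \in triangle_edges x y z
     & e2 \in triangle_edges x y z]) (in_triangle G e1 e2).
Proof.
apply: (iffP existsP) => [[x /existsP[y /existsP[z /and3P[t e1t e2t]]]]|].
  by exists x, y, z.
case=> [x [y [z [t e1t e2t]]]]; exists x; apply/existsP; exists y.
by apply/existsP; exists z; apply/and3P.
Qed.

Lemma triangle_edgesP G x y z p q : triangle G x y z ->
  [set p; q] \in triangle_edges x y z ->
  exists2 w, triangle G p q w & triangle_edges x y z = triangle_edges p q w.
Proof.
move=> /and3P[xy yz xz]; rewrite !inE !eq_set2.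
case/orP=> [/orP[]|] /orP[]/andP[/eqP ? /eqP ?]; subst p q;
  [exists z|exists z|exists x|exists x|exists y|exists y].
all: try by rewrite /triangle 1?[adj G z x]adj_sym 1?[adj G z y]adj_sym
  1?[adj G y x]adj_sym ?xy ?yz ?xz.
all: apply/setP=> e; rewrite !inE ?[[set z; x]]setUC ?[[set z; y]]setUC ?[[set y; x]]setUC.
all: by do 3 case: (e == _).
Qed.

(** On a chain of triangles from [f] to [e0], stop just before the first triangle that contains
    [e0]; up to there [R] applies to every link. *)
Lemma triangle_connected_ind K e0 (R : {set T} -> {set T} -> Prop) :
  triangle_connected K -> e0 \in edges K ->
  (forall f, R f f) -> (forall f1 f2 f3, R f1 f2 -> R f2 f3 -> R f1 f3) ->
  (forall x y z f1 f2, triangle K x y z -> e0 \notin triangle_edges x y z ->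
     f1 \in triangle_edges x y z -> f2 \in triangle_edges x y z -> R f1 f2) ->
  forall f, f \in edges K -> f != e0 ->
    exists f0, [/\ f0 != e0, in_triangle K f0 e0 & R f f0].
Proof.
move=> tK e0K Rr Rt Rs f fK fe0.
have /connectP[p] := tK f e0 fK e0K.
elim: p f {fK} fe0 => [|f' p IH] f fe0 /=; first by move=> _ E; rewrite E eqxx in fe0.
case/andP=> ff' pf' E; have /in_triangleP[x [y [z [t ft f't]]]] := ff'.
case e0t: (e0 \in triangle_edges x y z).
  by exists f; split=> //; apply/in_triangleP; exists x, y, z.
have f'e0 : f' != e0 by apply: contraFneq e0t => <-.
have [f0 [f0e f0t Rf']] := IH f' f'e0 pf' E.
by exists f0; split=> //; apply: Rt Rf'; apply: (Rs x y z); rewrite ?e0t.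
Qed.

Lemma in_triangle_pair K p q f : in_triangle K f [set p; q] -> f != [set p; q] ->
  exists w, [/\ adj K p w, adj K q w & f = [set p; w] \/ f = [set q; w]].
Proof.
case/in_triangleP=> x [y [z [t ft pqt]]] npq.
have [w /and3P[pq qw pw] E] := triangle_edgesP t pqt; exists w; split=> //.
move: ft; rewrite E !inE (negPf npq) /=.
by case/orP=> /eqP->; [right|left].
Qed.

Section Tight.
Variables (K : graph T) (p q : T).
Hypothesis (lK : laman K) (apq : adj K p q).

Definition del_edge := mkgraph (vertices K) (edges K :\ [set p; q]).

Lemma adj_del_edge x y :
  adj del_edge x y = adj K x y && ([set x; y] != [set p; q]).
Proof.
rewrite /adj !inE.
case xy: (_ \in edges K); rewrite ?andbF // andbT /=.
by rewrite (edge_proper xy) andbT.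
Qed.

Lemma size_in_del_edge X :
  size_in del_edge X + ((p \in X) && (q \in X)) = size_in K X.
Proof.
have iE : inside del_edge X = inside K X :\ [set p; q].
  apply/setP=> e; rewrite !inE; case: (e == _) => //=.
  by case eK: (_ \in _); rewrite //= (edge_proper eK).
rewrite /size_in (cardsD1 [set p; q] (inside K X)) iE addnC; congr (_ + _).
by rewrite inE subUset !sub1set [_ \in edges K]apq.
Qed.

Definition tight X := (1 < #|X|) && (size_in del_edge X + 3 == 2 * #|X|).

(** Putting [pq] back would make the set exceed the bound in [K]. *)
Lemma tight_avoid X : tight X -> p \in X -> q \in X -> False.
Proof.
case/andP=> X1 /eqP E pX qX; have := laman_sparse lK X1.
by rewrite -size_in_del_edge pX qX /=; lia.
Qed.

(** By supermodularity, the union and the intersection together have at least the maximal total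
    number of edges, so each of them attains its bound. *)
Lemma tightU X Y : tight X -> tight Y -> 1 < #|X :&: Y| -> tight (X :|: Y).
Proof.
case/andP=> X1 /eqP EX /andP[Y1 /eqP EY] I1.
have U1 : 1 < #|X :|: Y|.
  by apply: leq_trans X1 _; apply/subset_leq_card/subsetUl.
have := size_in_supermodular del_edge X Y.
have := size_in_del_edge (X :|: Y); have := size_in_del_edge (X :&: Y).
have := laman_sparse lK I1; have := laman_sparse lK U1; have := cardsUI X Y.
by rewrite /tight U1 => *; apply/eqP; lia.
Qed.

Lemma tight_edge x y : adj del_edge x y -> tight [set x; y].
Proof.
move=> a; have xy := adj_neq a; rewrite /tight cards2 xy /=.
rewrite size_inU1 ?inE // size_in_le1 ?cards1 //.
have -> : neighbors del_edge x :&: [set y] = [set y].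
  by apply/setIidPr; rewrite sub1set inE.
by rewrite cards1.
Qed.

Lemma tight_triangle x y z : triangle del_edge x y z -> tight [set x; y; z].
Proof.
case/and3P=> xy yz xz; rewrite setUC /tight.
have zxy : z \notin [set x; y].
  by rewrite !inE negb_or ![z == _]eq_sym (adj_neq xz) (adj_neq yz).
have /andP[_ /eqP E] := tight_edge xy.
rewrite size_inU1 // cardsU1 zxy.
have -> : neighbors del_edge z :&: [set x; y] = [set x; y].
  by apply/setIidPr/subsetP=> t; rewrite !inE adj_sym => /orP[]/eqP->.
move: E; rewrite cards2 (adj_neq xy) /= => E.
by apply/eqP; lia.
Qed.

(** Triangles that avoid [pq] are tight, and consecutive ones in a chain share an edge, so their
    unions stay tight. The chain ends at an edge from [p] or [q] to a common neighbor [w]. *)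
Lemma tight_cover x y : triangle_connected K ->
  adj K x y -> [set x; y] != [set p; q] ->
  exists w b X, [/\ adj K p w, adj K q w, b \in [set p; q], tight X
    & [/\ x \in X, y \in X, b \in X & w \in X]].
Proof.
move=> tK a npq.
(* The equality covers the empty chain. That [f2] is an edge is recorded because its two ends make
   [tightU] applicable when two sets are glued along [f2]. *)
pose R (f1 f2 : {set T}) := f1 = f2 \/
  exists X, [/\ tight X, f1 \subset X, f2 \subset X & f2 \in edges K].
have Rt f1 f2 f3 : R f1 f2 -> R f2 f3 -> R f1 f3.
  move=> [-> //|[X [tX f1X f2X f2K]]] [<-|[Y [tY f2Y f3Y f3K]]].
    by right; exists X.
  right; exists (X :|: Y); split=> //.
  + apply: tightU => //; have /andP[_ /eqP <-] := edge_proper f2K.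
    by apply: subset_leq_card; rewrite subsetI f2X.
  + exact: subset_trans f1X (subsetUl _ _).
  + exact: subset_trans f3Y (subsetUr _ _).
have Rs x1 y1 z1 f1 f2 : triangle K x1 y1 z1 ->
    [set p; q] \notin triangle_edges x1 y1 z1 ->
    f1 \in triangle_edges x1 y1 z1 -> f2 \in triangle_edges x1 y1 z1 -> R f1 f2.
  move=> t n f1t f2t; right; exists [set x1; y1; z1]; have /and3P[xy yz xz] := t; split.
  + apply: tight_triangle; rewrite /triangle !adj_del_edge xy yz xz /=.
    by move: n; rewrite !inE !negb_or ![[set p; q] == _]eq_sym => /andP[/andP[-> ->] ->].
  + apply/subsetP=> t1; move: f1t; rewrite !inE => /orP[/orP[]|] /eqP->;
    by rewrite !inE => /orP[] ->; rewrite ?orbT.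
  + apply/subsetP=> t1; move: f2t; rewrite !inE => /orP[/orP[]|] /eqP->;
    by rewrite !inE => /orP[] ->; rewrite ?orbT.
  + by move: f2t; rewrite !inE => /orP[/orP[]|] /eqP->.
have [f0 [f0n f0t Rf]] :=
  triangle_connected_ind tK apq (fun f => or_introl erefl) Rt Rs a npq.
have [w [pw qw f0E]] := in_triangle_pair f0t f0n.
have [b bpq f0b] : exists2 b, b \in [set p; q] & f0 = [set b; w].
  by case: f0E => ->; [exists p | exists q]; rewrite // !inE eqxx ?orbT.
case: Rf => [E|[X [tX /subsetP xX /subsetP f0X _]]].
  exists w, b, [set x; y]; rewrite E f0b; split=> //; last first.
    have := set21 x y; have := set22 x y; rewrite E f0b => -> ->.
    by rewrite set21 set22.
  by rewrite -f0b -E; apply: tight_edge; rewrite adj_del_edge a.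
exists w, b, X; split=> //; split; [apply: xX|apply: xX|apply: f0X|apply: f0X];
by rewrite ?f0b !inE eqxx ?orbT.
Qed.

(** Here [c] is the end of [pq] missing from [X]. It brings the edges [cb] and [cw]; the bound in
    [K] permits no third one and is therefore attained. *)
Lemma tight_extend X b c w : tight X -> b \in X -> w \in X ->
  adj K c b -> adj K c w -> b != w -> [set c; b] = [set p; q] ->
  [/\ c \notin X, size_in K (c |: X) + 3 = 2 * #|c |: X|
    & neighbors K c :&: X = [set b; w]].
Proof.
move=> tX bX wX cb cw bw E.
have nX : ~~ ((p \in X) && (q \in X)).
  by apply/negP=> /andP[]; exact: tight_avoid.
have cX : c \notin X.
  apply: contra nX => cX; move/eqP: E; rewrite eq_set2.
  by case/orP=> /andP[/eqP<- /eqP<-]; rewrite bX cX.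
have /andP[X1 /eqP EX] := tX.
have sX := size_in_del_edge X; rewrite (negPf nX) addn0 in sX.
have cE : #|c |: X| = #|X|.+1 by rewrite cardsU1 cX.
have cX1 : 1 < #|c |: X| by rewrite cE ltnW.
have h1 := laman_sparse lK cX1; have h2 := size_inU1 K cX.
have sub : [set b; w] \subset neighbors K c :&: X.
  by apply/subsetP=> t; rewrite !inE => /orP[]/eqP->; rewrite ?cb ?cw ?bX ?wX.
have h3 := subset_leq_card sub; rewrite cards2 bw /= in h3.
have N2 : #|neighbors K c :&: X| = 2 by clear -h1 h2 h3 sX EX cE; lia.
split=> //; first by clear -h2 N2 sX EX cE; lia.
by apply/esym/eqP; rewrite eqEcard sub cards2 bw N2.
Qed.

Lemma other_end b w : adj K p w -> adj K q w -> b \in [set p; q] ->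
  exists c, [/\ adj K c b, adj K c w, b != w, [set c; b] = [set p; q]
    & c \in [set p; q]].
Proof.
move=> pw qw; rewrite !inE => /orP[]/eqP->; [exists q|exists p].
  by rewrite adj_sym apq qw (adj_neq pw) setUC !inE eqxx orbT.
by rewrite apq pw (adj_neq qw) !inE eqxx.
Qed.

(** Enlarge [X] and [Y] by the missing ends [c] and [c'] of [pq]; both sets then attain the bound in
    [K], hence so does their intersection [Z]. In [Z] the vertex [c] has at most the neighbor [b],
    because [w] is not in [Y'], so deleting [c] leaves too many edges. A common vertex [x] outside
    [pq] ensures that at least two vertices remain. *)
Lemma tight_meet X Y b b' w w' x :
  adj K p w -> adj K q w -> adj K p w' -> adj K q w' -> w != w' ->
  tight X -> b \in [set p; q] -> b \in X -> w \in X ->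
  tight Y -> b' \in [set p; q] -> b' \in Y -> w' \in Y ->
  x \in X -> x \in Y -> x \in [set p; q].
Proof.
move=> pw qw pw' qw' ww' tX bpq bX wX tY bpq' bY wY xX xY.
apply: contraT => xpq.
have [c [cb cw bw cE cpq]] := other_end pw qw bpq.
have [c' [cb' cw' bw' cE' cpq']] := other_end pw' qw' bpq'.
have [cX sX NX] := tight_extend tX bX wX cb cw bw cE.
have [c'Y sY NY] := tight_extend tY bY wY cb' cw' bw' cE'.
have npq t : adj K p t -> adj K q t -> t \notin [set p; q].
  by move=> pt qt; rewrite !inE negb_or ![t == _]eq_sym (adj_neq pt) (adj_neq qt).
have c'w : adj K c' w by move: cpq'; rewrite !inE => /orP[]/eqP->.
(* In [Y] the neighbors of [c'] are only [b'] and [w'], whereas [w] is a further common neighbor of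
   [p] and [q]. *)
have wY' : w \notin c' |: Y.
  rewrite in_setU1 negb_or eq_sym (adj_neq c'w) /=; apply/negP=> wY1.
  have : w \in neighbors K c' :&: Y by rewrite inE in_neighbors c'w.
  rewrite NY in_set2 (negPf ww') orbF => /eqP E.
  by have := npq _ pw qw; rewrite E bpq'.
have sub t : t \in [set p; q] -> t \in c |: X /\ t \in c' |: Y.
  move=> tpq; split; move: tpq; [rewrite -cE|rewrite -cE'].
    by rewrite !inE => /orP[]/eqP->; rewrite ?bX ?eqxx ?orbT.
  by rewrite !inE => /orP[]/eqP->; rewrite ?bY ?eqxx ?orbT.
set X' := c |: X in sX sub *; set Y' := c' |: Y in sY sub wY' *.
have [cX' cY'] := sub c cpq; have [bX' bY'] := sub b bpq.
pose Z := X' :&: Y'; have cZ : c \in Z by rewrite inE cX'.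
have bx : b != x by apply: contraNneq xpq => <-.
have Z2 : 1 < #|Z :\ c|.
  have sZ : [set b; x] \subset Z :\ c.
    apply/subsetP=> t tbx; rewrite in_setD1 in_setI.
    move: tbx; rewrite in_set2 => /orP[]/eqP->.
      by rewrite eq_sym (adj_neq cb) bX' bY'.
    by rewrite !setU1r // !andbT; apply: contraNneq xpq => ->.
  by have := subset_leq_card sZ; rewrite cards2 bx.
have N1 : #|neighbors K c :&: (Z :\ c)| <= 1.
  rewrite -(cards1 b); apply/subset_leq_card/subsetP=> t.
  rewrite in_setI in_neighbors in_setD1 in_setI => /and4P[ct /negPf tc].
  rewrite in_setU1 tc /= => tX' tY'.
  have : t \in neighbors K c :&: X by rewrite !inE ct.
  by rewrite NX in_set2 in_set1 => /orP[->//|/eqP tw]; rewrite -tw tY' in wY'.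
have U1 : 1 < #|X' :|: Y'|.
  apply: leq_trans Z2 _; apply/subset_leq_card; apply: subset_trans (subsetDl _ _) _.
  by apply: subset_trans (subsetIl _ _) (subsetUl _ _).
have hZ := laman_sparse lK Z2; have hU := laman_sparse lK U1.
have hm := size_in_supermodular K X' Y'; have hc := cardsUI X' Y'.
have hZc := size_inU1 K (negbT (setD11 c Z)); rewrite setD1K // in hZc.
have cZ' : #|Z| = #|Z :\ c|.+1 by rewrite (cardsD1 c Z) cZ.
rewrite -/Z in hm hc; clear -sX sY N1 hZ hU hm hc hZc cZ'.
by clearbody Z; clearbody X' Y'; exfalso; lia.
Qed.
End Tight.
End TightSets.

(** * Colorings when the reduced graph is triangle-connected *)

Section ExplicitColorings.
Variable T : finType.
Implicit Types (G H K : graph T) (x y z u v w p q : T) (e : {set T}).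
Implicit Types (X Y A : {set T}).

Lemma in_triangle_sym G : symmetric (in_triangle G).
Proof.
by move=> e1 e2; apply/in_triangleP/in_triangleP => -[x [y [z [t h1 h2]]]];
  exists x, y, z.
Qed.

Lemma triangle_connected_to G e0 :
  (forall e, e \in edges G -> connect (in_triangle G) e e0) ->
  triangle_connected G.
Proof.
move=> h e1 e2 e1G e2G; apply: connect_trans (h _ e1G) _.
rewrite (sym_connect_sym (@in_triangle_sym G)); exact: h.
Qed.

Lemma triangle_connect G x y z : triangle G x y z ->
  connect (in_triangle G) [set x; y] [set y; z] /\
  connect (in_triangle G) [set x; y] [set x; z].
Proof.
by move=> t; split; apply/connect1/in_triangleP; exists x, y, z;
  rewrite !inE !eqxx ?orbT.
Qed.

Section TightMore.
Variables (K : graph T) (p q : T).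
Hypothesis (lK : laman K) (apq : adj K p q).
Let tight := tight K p q.

(** If [w = w'], a second common vertex would make the union tight, although it contains both [p]
    and [q]. If [w] and [w'] differ, [tight_meet] puts [x] in [pq], which [tight_avoid] excludes. *)
Lemma tight_apex X Y w w' x :
  adj K p w -> adj K q w -> adj K p w' -> adj K q w' ->
  tight X -> p \in X -> w \in X -> tight Y -> q \in Y -> w' \in Y ->
  x \in X -> x \in Y -> x = w /\ x = w'.
Proof.
move=> pw qw pw' qw' tX pX wX tY qY wY xX xY.
have [ww'|ww'] := eqVneq w w'.
  rewrite -ww'; suff -> : x = w by [].
  apply/eqP; apply: contraT => xw; case: (tight_avoid lK apq (tightU lK apq tX tY _)).
  - have sI : [set x; w] \subset X :&: Y.
      by apply/subsetP=> t; rewrite !inE => /orP[]/eqP->; rewrite ?xX ?xY ?wX ?ww' ?wY.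
    by have := subset_leq_card sI; rewrite cards2 xw.
  - by rewrite inE pX.
  - by rewrite inE qY orbT.
have := tight_meet lK apq pw qw pw' qw' ww' tX (set21 p q) pX wX tY (set22 p q) qY wY xX xY.
rewrite !inE => /orP[]/eqP xE; subst x.
  by case: (tight_avoid lK apq tY xY qY).
by case: (tight_avoid lK apq tX pX xX).
Qed.

Lemma tight_spoke b w : adj K p w -> adj K q w -> b \in [set p; q] ->
  tight [set b; w].
Proof.
move=> pw qw bpq; apply: tight_edge; rewrite adj_del_edge.
have -> : adj K b w by move: bpq; rewrite !inE => /orP[]/eqP->.
by rewrite eq_set2 negb_or !negb_and ![w == _]eq_sym (adj_neq pw) (adj_neq qw) !orbT.
Qed.

(* Removing [p] and [q] separates this set from [c]. *)
Definition beyond c : {set T} := [set x in vertices K | (x \notin [set p; q]) &&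
  [exists w, exists b, exists Y : {set T},
     [&& adj K p w, adj K q w, w != c, b \in [set p; q],
         tight Y, b \in Y, w \in Y & x \in Y]]].

Lemma beyondP c x : reflect
  [/\ x \in vertices K, x \notin [set p; q] & exists w b Y,
     [/\ [/\ adj K p w, adj K q w & w != c], b \in [set p; q]
       & [/\ tight Y, b \in Y, w \in Y & x \in Y]]] (x \in beyond c).
Proof.
rewrite /beyond in_set; apply: (iffP and3P) => -[xK xpq h]; split=> //.
  case/existsP: h => w /existsP[b /existsP[Y]].
  by case/and5P=> pw qw wc bpq /and4P[*]; exists w, b, Y.
case: h => w [b [Y [[pw qw wc] bpq [tY bY wY xY]]]].
apply/existsP; exists w; apply/existsP; exists b; apply/existsP; exists Y.
by rewrite pw qw wc tY bY wY xY bpq.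
Qed.

Lemma apex_beyond c w : adj K p w -> adj K q w -> w != c -> w \in beyond c.
Proof.
move=> pw qw wc; apply/beyondP; split.
- by apply: (adj_vertex (y := p)); rewrite adj_sym.
- by rewrite !inE negb_or ![w == _]eq_sym (adj_neq pw) (adj_neq qw).
- by exists w, p, [set p; w]; rewrite !inE !eqxx orbT tight_spoke ?inE ?eqxx.
Qed.

Lemma not_beyond c b X x : adj K p c -> adj K q c ->
  tight X -> b \in [set p; q] -> b \in X -> c \in X -> x \in X -> x \notin beyond c.
Proof.
move=> pc qc tX bpq bX cX xX; apply/beyondP => -[xK xpq].
case=> w [b' [Y [[pw qw wc] bpq' [tY bY wY xY]]]].
by rewrite (tight_meet lK apq pw qw pc qc wc tY bpq' bY wY tX bpq bX cX xY xX) in xpq.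
Qed.

(** The tight set that covers the edge [xy] is not attached to [c], since [x] is beyond [c]; so it
    also places [y] beyond [c]. *)
Lemma beyond_closed c x y : triangle_connected K ->
  adj K p c -> adj K q c -> x \in beyond c -> adj K x y -> y \notin [set p; q] ->
  y \in beyond c.
Proof.
move=> tK pc qc xD xy ypq; have [_ xpq _] := beyondP _ _ xD.
have npq : [set x; y] != [set p; q].
  by apply: contraNneq xpq => <-; rewrite set21.
have [w [b [X [pw qw bpq tX [xX yX bX wX]]]]] := tight_cover lK apq tK xy npq.
have [wc|wc] := eqVneq w c.
  by subst w; have := not_beyond pc qc tX bpq bX wX xX; rewrite xD.
apply/beyondP; split=> //; first by apply: (adj_vertex (y := x)); rewrite adj_sym.
by exists w, b, X.
Qed.
End TightMore.

(** If [p] and [q] have no common neighbor in [K] other than [c], the triangles [vpc] and [vqc]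
    replace [pq] in every chain and [G] is triangle-connected. Otherwise [beyond K p q c] is
    nonempty and is joined to the rest of [G] only through the nonadjacent vertices [p] and [q], so
    [cut_nac] applies. *)
Lemma diamond_nac G v c p q (K := add_edge (remove G v) p q) :
  (forall x, adj G v x = (x \in [set c; p; q])) ->
  adj G c p -> adj G c q -> p != q -> ~~ adj G p q -> laman K ->
  triangle_connected K -> ~ triangle_connected G -> has_nac_coloring G.
Proof.
move=> vN cp cq pq npq lK tK ntG.
have vc : adj G v c by rewrite vN !inE eqxx.
have vp : adj G v p by rewrite vN !inE eqxx orbT.
have vq : adj G v q by rewrite vN !inE eqxx orbT.
have inK x : x != v -> adj G v x -> x \in vertices (remove G v).
  by move=> xv vx; rewrite !inE xv (adj_vertex (y := v)) // adj_sym.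
have pv : p != v by rewrite eq_sym (adj_neq vp).
have qv : q != v by rewrite eq_sym (adj_neq vq).
have cv : c != v by rewrite eq_sym (adj_neq vc).
have Kadj x y : adj K x y =
    [&& adj G x y, x != v & y != v] || ([set x; y] == [set p; q]).
  by rewrite adj_add_edge ?adj_remove ?inK.
have apq : adj K p q by rewrite Kadj eqxx orbT.
have pc : adj K p c by rewrite Kadj adj_sym cp pv cv.
have qc : adj K q c by rewrite Kadj adj_sym cq qv cv.
have KG x y : adj K x y -> [set x; y] != [set p; q] -> adj G x y.
  by rewrite Kadj => /orP[/and3P[]|->].
have vK : v \notin vertices K by rewrite !inE eqxx.
have [/existsP[w /and3P[pw qw wc]]|/existsPn now] :=
    boolP [exists w, [&& adj K p w, adj K q w & w != c]]; last first.
  case: ntG; apply: (@triangle_connected_to _ [set p; c]) => f fG.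
  have sym := sym_connect_sym (@in_triangle_sym G).
  have tvpc : triangle G v p c by rewrite /triangle vp adj_sym cp vc.
  have tvqc : triangle G v q c by rewrite /triangle vq adj_sym cq vc.
  have [vp_pc vp_vc] := triangle_connect tvpc.
  have [vq_qc vq_vc] := triangle_connect tvqc.
  have vc_pc : connect (in_triangle G) [set v; c] [set p; c].
    by apply: connect_trans vp_pc; rewrite sym.
  have vq_pc := connect_trans vq_vc vc_pc.
  have qc_pc : connect (in_triangle G) [set q; c] [set p; c].
    by apply: connect_trans vq_pc; rewrite sym.
  case vf: (v \in f).
    have [x -> ] := edge_at fG vf; rewrite vN !inE.
    by case/orP=> [/orP[]|] /eqP->.
  have [x [y [fE xy]]] := edge_adj fG.
  have [xv yv] : x != v /\ y != v.
    by split; apply: contraFneq vf => <-; rewrite fE !inE eqxx ?orbT.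
  have fK : f \in edges K by rewrite fE -/(adj K x y) Kadj xy xv yv.
  have fn : f != [set p; q] by apply: contraNneq npq => E; rewrite /adj -E.
  have Rs x1 y1 z1 f1 f2 : triangle K x1 y1 z1 ->
      [set p; q] \notin triangle_edges x1 y1 z1 ->
      f1 \in triangle_edges x1 y1 z1 -> f2 \in triangle_edges x1 y1 z1 ->
      connect (in_triangle G) f1 f2.
    case/and3P=> a1 a2 a3 n t1 t2; apply/connect1/in_triangleP; exists x1, y1, z1.
    split=> //; move: n; rewrite !inE !negb_or ![[set p; q] == _]eq_sym.
    by case/andP=> /andP[n1 n2] n3; rewrite /triangle !KG.
  have Rt f1 f2 f3 := @connect_trans _ (in_triangle G) f2 f1 f3.
  have [f0 [f0n f0t Rf]] :=
    triangle_connected_ind tK apq (@connect0 _ (in_triangle G)) Rt Rs fK fn.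
  have [w [pw qw]] := in_triangle_pair f0t f0n.
  have := now w; rewrite pw qw negbK /= => /eqP ->.
  by case=> E; rewrite E in Rf; apply: connect_trans Rf _.
have cD : c \notin beyond K p q c.
  apply: (not_beyond lK apq pc qc (tight_spoke pc qc (set21 p q)) (set21 p q));
  by rewrite !inE eqxx ?orbT.
have notpq x : x \in beyond K p q c -> x \notin [set p; q] by case/beyondP.
have vD : v \notin beyond K p q c by apply: contra vK => /beyondP[].
(* The vertex [v] is not adjacent to the set either: its neighbors [c], [p] and [q] are not in
   it. *)
have bd a x : a \in beyond K p q c -> adj G a x -> x \notin beyond K p q c ->
    x \in [set p; q].
  move=> aD ax xD; apply: contraT => xpq.
  have av : a != v by apply: contraNneq vD => <-.
  have [xv|xv] := eqVneq x v.
    move: ax; rewrite xv adj_sym vN -setUA in_setU1 (negPf (notpq _ aD)) orbF.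
    by move/eqP=> aE; rewrite aE (negPf cD) in aD.
  have ax' : adj K a x by rewrite Kadj ax av xv.
  by rewrite (beyond_closed lK apq tK pc qc aD ax' xpq) in xD.
apply: (@cut_nac _ _ (beyond K p q c)) => [x y xy xD yD [a aD ax] [b bD bY]||].
- have := bd a x aD ax xD; have := bd b y bD bY yD.
  have xny := adj_neq xy.
  rewrite !inE => /orP[]/eqP yE /orP[]/eqP xE; subst x y; rewrite ?eqxx // in xny.
    by rewrite adj_sym (negPf npq) in xy.
  by rewrite xy in npq.
- exists w, p; split; last exact: apex_beyond.
  rewrite adj_sym; apply: KG => //.
  by rewrite eq_set2 negb_or !negb_and ![w == _]eq_sym (adj_neq pw) (adj_neq qw) !orbT.
- exists v, p; split=> //; apply: contraL (set21 p q) => pD.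
  exact: notpq pD.
Qed.

(* Edges in tight sets through [u] and the triangle [vwy] get one color, edges in
   tight sets through [y] and the edges [uv], [wa] the other one. *)
Lemma prism_nac G K v w y u a :
  (forall x, adj G v x = (x \in [set u; w; y])) ->
  (forall x, adj G w x = (x \in [set v; y; a])) ->
  adj G u a -> ~~ adj G a y -> ~~ adj G u y ->
  u != w -> a != v -> a != y ->
  (forall x z, adj K x z = [&& adj G x z, x \notin [set v; w] & z \notin [set v; w]]
     || ([set x; z] == [set u; y])) ->
  laman K -> triangle_connected K -> has_nac_coloring G.
Proof.
move=> vN wN ua nay nuy uw av ay Kadj lK tK.
have vu : adj G v u by rewrite vN !inE eqxx.
have vw : adj G v w by rewrite vN !inE eqxx orbT.
have vy : adj G v y by rewrite vN !inE eqxx orbT.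
have wa : adj G w a by rewrite wN !inE eqxx orbT.
have wy : adj G w y by rewrite wN !inE eqxx orbT.
have uy : u != y by apply: contraNneq nay => <-; rewrite adj_sym.
have aw : a != w by rewrite eq_sym (adj_neq wa).
have uv : u != v by rewrite eq_sym (adj_neq vu).
have aua : adj K u a by rewrite Kadj ua !inE !negb_or uv uw av aw.
have auy : adj K u y by rewrite Kadj eqxx orbT.
pose tight := tight K u y.
pose apex s := adj K u s && adj K y s.
have tU X : tight X -> u \in X -> y \in X -> False := @tight_avoid _ _ _ _ lK auy X.
pose Us := [set x | [exists s, exists X : {set T},
  [&& apex s, tight X, u \in X, s \in X & x \in X]]].
pose Ws := [set x | [exists s, exists X : {set T},
  [&& apex s, tight X, y \in X, s \in X & x \in X]]].
have UP x : reflect (exists s X, [/\ apex s, tight X, u \in X, s \in X & x \in X]) (x \in Us).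
  rewrite inE; apply: (iffP existsP) => -[s]; first by case/existsP=> X /and5P[*]; exists s, X.
  by case=> X h; exists s; apply/existsP; exists X; apply/and5P.
have WP x : reflect (exists s X, [/\ apex s, tight X, y \in X, s \in X & x \in X]) (x \in Ws).
  rewrite inE; apply: (iffP existsP) => -[s]; first by case/existsP=> X /and5P[*]; exists s, X.
  by case=> X h; exists s; apply/existsP; exists X; apply/and5P.
(* A tight set through [u] meets [Ws] at most in its apex; below, the same for [y] and [Us]. *)
have XW s X x : apex s -> tight X -> u \in X -> s \in X -> x \in X -> x \in Ws -> x = s.
  move=> /andP[us ys] tX uX sX xX /WP[s' [Y [/andP[us' ys'] tY yY sY xY]]].
  by have [] := tight_apex lK auy us ys us' ys' tX uX sX tY yY sY xX xY.
have XU s X x : apex s -> tight X -> y \in X -> s \in X -> x \in X -> x \in Us -> x = s.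
  move=> /andP[us ys] tX yX sX xX /UP[s' [Y [/andP[us' ys'] tY uY sY xY]]].
  by have [] := tight_apex lK auy us' ys' us ys tY uY sY tX yX sX xY xX.
have yU : y \notin Us by apply/UP => -[s [X [_ tX uX _ yX]]]; apply: tU tX uX yX.
have uW : u \notin Ws by apply/WP => -[s [X [_ tX yX _ uX]]]; apply: tU tX uX yX.
have Kvw x z : adj K x z -> x \notin [set v; w].
  rewrite Kadj => /orP[/and3P[] //|]; rewrite eq_set2.
  have yv : y != v by rewrite eq_sym (adj_neq vy).
  have yw : y != w by rewrite eq_sym (adj_neq wy).
  by case/orP=> /andP[/eqP-> _]; rewrite !inE negb_or ?uv ?uw ?yv ?yw.
have cover x z : adj K x z -> [set x; z] != [set u; y] -> exists s X,
    [/\ apex s, tight X, s \in X, (x \in X) && (z \in X) & (u \in X) || (y \in X)].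
  move=> xz n; have [s [b [X [us ys bpq tX [xX zX bX sX]]]]] := tight_cover lK auy tK xz n.
  exists s, X; rewrite /apex us ys xX zX; split=> //.
  by move: bpq; rewrite !inE => /orP[]/eqP E; rewrite -E bX ?orbT.
have ua_uy : [set u; a] != [set u; y].
  by rewrite eq_set2 eqxx (negPf ay) (negPf uy).
have [s [X [as_ tX sX /andP[uX aX] _]]] := cover _ _ aua ua_uy.
have aU : a \in Us by apply/UP; exists s, X.
have uU : u \in Us by apply/UP; exists s, X.
(* In [Ws], the vertex [a] would be the apex [s], hence adjacent to [y] in [K]. *)
have aW : a \notin Ws.
  apply/negP=> /(XW s X a as_ tX uX sX aX) E; case/andP: as_ => _; rewrite -E Kadj.
  by rewrite adj_sym (negPf nay) eq_set2 (negPf ay) [a == u]eq_sym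
    (negPf (adj_neq ua)) !andbF.
have yW : y \in Ws.
  apply/WP; exists s, [set y; s]; rewrite /tight !set21 !set22; split=> //.
  by case/andP: as_ => us ys; apply: (tight_spoke us ys (set22 u y)).
(* [f1] contracts [Us] and [g1] contracts [Ws]. The vertex [v] is put at [(y, u)] and [w] at
   [(y, a)], while [u], [a], [y] land on [(u, u)], [(u, a)], [(y, y)]; so [v], [w], [y] share the
   first coordinate, and each of the edges [uv] and [wa] keeps the second. *)
pose f1 x := if x \in Us then u else x.
pose g1 x := if x \in Ws then y else x.
pose f x := f1 (if x \in [set v; w] then y else x).
pose g x := g1 (if x == v then u else if x == w then a else x).
(* Both ends of an edge in a tight set through [u] are contracted by [f1], but at most one of them,
   the apex, by [g1]. For tight sets through [y] the roles are exchanged. *)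
have KK x z : adj K x z -> [set x; z] != [set u; y] -> (f1 x == f1 z) = (g1 x != g1 z).
  move=> xz n; have [s' [Y [as' tY sY /andP[xY zY] bY]]] := cover _ _ xz n.
  have xnz := adj_neq xz; case/orP: bY => bY.
    have xU : x \in Us by apply/UP; exists s', Y.
    have zU : z \in Us by apply/UP; exists s', Y.
    rewrite /f1 xU zU eqxx /g1; apply/esym.
    case: (boolP (x \in Ws)) => xW; case: (boolP (z \in Ws)) => zW //.
    - by rewrite (XW _ _ _ as' tY bY sY xY xW) (XW _ _ _ as' tY bY sY zY zW) eqxx in xnz.
    - by apply: contraNneq zW => <-.
    - by apply: contraNneq xW => ->.
  have xW : x \in Ws by apply/WP; exists s', Y.
  have zW : z \in Ws by apply/WP; exists s', Y.
  rewrite /g1 xW zW eqxx /f1; apply/negbTE.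
  case: (boolP (x \in Us)) => xU; case: (boolP (z \in Us)) => zU //.
  - by rewrite (XU _ _ _ as' tY bY sY xY xU) (XU _ _ _ as' tY bY sY zY zU) eqxx in xnz.
  - by apply: contraNneq zU => <-.
  - by apply: contraNneq xU => ->.
have wv : (w == v) = false by rewrite eq_sym (negPf (adj_neq vw)).
have fv : f v = y by rewrite /f set21 /f1 (negPf yU).
have fw : f w = y by rewrite /f set22 /f1 (negPf yU).
have gv : g v = u by rewrite /g eqxx /g1 (negPf uW).
have gw : g w = a by rewrite /g wv eqxx /g1 (negPf aW).
have uvw := Kvw _ _ auy.
have yvw : y \notin [set v; w] by apply: (Kvw y u); rewrite adj_sym.
have avw : a \notin [set v; w] by apply: (Kvw a u); rewrite adj_sym.
have fK x : x \notin [set v; w] -> f x = f1 x by rewrite /f => /negPf->.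
have gK x : x \notin [set v; w] -> g x = g1 x.
  by rewrite /g !inE negb_or => /andP[/negPf-> /negPf->].
have fu : f u = u by rewrite fK // /f1 uU.
have fa : f a = u by rewrite fK // /f1 aU.
have fy : f y = y by rewrite fK // /f1 (negPf yU).
have gu : g u = u by rewrite gK // /g1 (negPf uW).
have ga : g a = a by rewrite gK // /g1 (negPf aW).
have gy : g y = y by rewrite gK // /g1 yW.
have vG x : adj G v x -> (f v == f x) = (g v != g x).
  rewrite vN !inE fv gv => /orP[/orP[]|] /eqP->.
  - by rewrite fu gu eqxx eq_sym (negPf uy).
  - by rewrite fw gw eqxx (adj_neq ua).
  - by rewrite fy gy eqxx uy.
have wG x : adj G w x -> (f w == f x) = (g w != g x).
  rewrite wN !inE fw gw => /orP[/orP[]|] /eqP->.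
  - by rewrite fv gv eqxx eq_sym (adj_neq ua).
  - by rewrite fy gy eqxx ay.
  - by rewrite fa ga eqxx eq_sym (negPf uy).
have vwG x z : adj G x z -> x \in [set v; w] -> (f x == f z) = (g x != g z).
  by move=> xz; rewrite !inE => /orP[]/eqP E; subst x; [exact: vG|exact: wG].
apply: (@on_grid_nac _ _ _ _ f g); split.
- move=> x z xz; case: (boolP (x \in [set v; w])) => [|xvw]; first exact: vwG.
  case: (boolP (z \in [set v; w])) => [zvw|zvw].
    by rewrite eq_sym [g x == _]eq_sym; apply: vwG => //; rewrite adj_sym.
  rewrite !fK // !gK //; apply: KK; first by rewrite Kadj xz xvw zvw.
  by apply: contraNneq nuy => E; rewrite /adj -E.
- by exists v, w; rewrite fv fw.
- by exists v, u; rewrite gv gu.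
Qed.
End ExplicitColorings.

(** * Inverse Henneberg moves *)

Section HennebergReductions.
Variable T : finType.
Implicit Types (G H K : graph T) (x y z u v w p q : T) (e : {set T}).
Implicit Types (X Y A : {set T}).

Lemma edges_remove G v A : (forall x, adj G v x = (x \in A)) ->
  edges G = edges (remove G v) :|: [set [set x; v] | x in A].
Proof.
move=> vN; apply/setP=> e; rewrite in_setU; apply/idP/orP => [eG|[eK|/imsetP[x xA ->]]].
- have [x [y [-> xy]]] := edge_adj eG; case: (eqVneq x v) => [xv|xv].
    by right; apply/imsetP; exists y; rewrite -?vN -?xv // setUC.
  case: (eqVneq y v) => [yv|yv].
    by right; apply/imsetP; exists x; rewrite -?vN -?yv // adj_sym.
  by left; rewrite -/(adj (remove G v) x y) adj_remove xy xv.
- by have [x [y [-> ]]] := edge_adj eK; rewrite adj_remove => /andP[].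
- by rewrite setUC -/(adj G v x) vN.
Qed.

Lemma edges_add_edge G p q : p \in vertices G -> q \in vertices G -> p != q ->
  ~~ adj G p q -> edges (add_edge G p q) :\ [set p; q] = edges G.
Proof.
move=> pG qG pq npq; apply/setP=> e; rewrite in_setD1; apply/andP/idP.
  case=> en eK; have [x [y [eE]]] := edge_adj eK.
  by rewrite adj_add_edge // -eE (negPf en) orbF /adj -eE.
move=> eG; have [x [y [eE xy]]] := edge_adj eG; split.
  by apply: contraNneq npq => E; rewrite /adj -E.
by rewrite eE -/(adj (add_edge G p q) x y) adj_add_edge // xy.
Qed.

Lemma remove_henneberg1 G v x y : (forall z, adj G v z = (z \in [set x; y])) ->
  x != y -> henneberg1 (remove G v) G.
Proof.
move=> vN xy.
have inK z : z \in [set x; y] -> z \in vertices (remove G v).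
  rewrite -vN => vz; rewrite !inE eq_sym (adj_neq vz).
  by apply: (adj_vertex (y := v)); rewrite adj_sym.
exists v, x, y; split.
- by rewrite !inE eqxx.
- by split=> //; apply: inK; rewrite !inE eqxx ?orbT.
- by rewrite /= setD1K // (adj_vertex (y := x)) // vN set21.
- by rewrite (edges_remove vN) imsetU !imset_set1.
Qed.

Lemma move_henneberg2 G v c p q : (forall x, adj G v x = (x \in [set c; p; q])) ->
  c != p -> c != q -> p != q -> ~~ adj G p q ->
  henneberg2 (add_edge (remove G v) p q) G.
Proof.
move=> vN cp cq pq npq.
have inK z : z \in [set c; p; q] -> z \in vertices (remove G v).
  rewrite -vN => vz; rewrite !inE eq_sym (adj_neq vz).
  by apply: (adj_vertex (y := v)); rewrite adj_sym.
have [cK pK qK] : [/\ c \in vertices (remove G v), p \in vertices (remove G v)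
    & q \in vertices (remove G v)].
  by split; apply: inK; rewrite !inE eqxx ?orbT.
exists v, c, p, q; split=> //.
- by rewrite !inE eqxx.
- by split=> //; rewrite -/(adj _ p q) adj_add_edge // eqxx orbT.
- by rewrite /= setD1K // (adj_vertex (y := c)) // vN !inE eqxx.
- rewrite edges_add_edge //; last by rewrite adj_remove negb_and npq.
  by rewrite (edges_remove vN) !imsetU !imset_set1.
Qed.

Lemma size_inU1_ge G v X A : v \notin X -> A \subset X ->
  (forall x, x \in A -> adj G v x) -> size_in G X + #|A| <= size_in G (v |: X).
Proof.
move=> vX AX vA; rewrite size_inU1 // leq_add2l; apply/subset_leq_card.
by apply/subsetP=> x xA; rewrite !inE (subsetP AX) // vA.
Qed.

Lemma cards3 x y z : x != y -> x != z -> y != z -> #|[set x; y; z]| = 3.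
Proof.
by move=> xy xz yz; rewrite setUC cardsU1 cards2 xy !inE ![z == _]eq_sym
  (negPf xz) (negPf yz).
Qed.

Lemma degreeE G v A : (forall x, adj G v x = (x \in A)) -> degree G v = #|A|.
Proof. by move=> vN; apply: eq_card => x; rewrite inE vN. Qed.

(** Four vertices span at most five edges, while adding the vertices one at a time would give
    [1 + 2 + 3]. *)
Lemma laman_K4_free G v c p q : laman G -> adj G v c -> adj G v p -> adj G v q ->
  adj G c p -> adj G c q -> ~~ adj G p q.
Proof.
move=> lG vc vp vq cp cq; apply/negP=> pq.
have h1 := @size_inU1_ge G p [set q] [set q].
have h2 := @size_inU1_ge G c [set p; q] [set p; q].
have h3 := @size_inU1_ge G v [set c; p; q] [set c; p; q].
have c3 := cards3 (adj_neq cp) (adj_neq cq) (adj_neq pq).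
have vX : v \notin [set c; p; q].
  by rewrite !inE !negb_or (adj_neq vc) (adj_neq vp) (adj_neq vq).
have c4 : #|v |: [set c; p; q]| = 4 by rewrite cardsU1 vX c3.
have h4 := @laman_sparse _ _ lG (v |: [set c; p; q]); rewrite c4 in h4.
rewrite cards1 in h1; rewrite cards2 (adj_neq pq) in h2; rewrite c3 in h3.
have {}h1 := h1 _ (subxx _) _; have {}h2 := h2 _ (subxx _) _.
have {}h3 := h3 vX (subxx _) _; rewrite setUA in h2.
have {}h1 : size_in G [set q] + 1 <= size_in G [set p; q].
  by apply: h1 => [|x]; rewrite inE ?(adj_neq pq) // => /eqP->.
have {}h2 : size_in G [set p; q] + 2 <= size_in G [set c; p; q].
  apply: h2 => [|x]; first by rewrite !inE negb_or (adj_neq cp) (adj_neq cq).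
  by rewrite !inE => /orP[]/eqP->.
have {}h3 : size_in G [set c; p; q] + 3 <= size_in G (v |: [set c; p; q]).
  by apply: h3 => x; rewrite !inE => /orP[/orP[]|]/eqP->.
have {}h4 := h4 isT; clear -h1 h2 h3 h4; lia.
Qed.

(** A set with [p] and [q] but without [v] can be enlarged by [c], if absent, with at least two
    edges, and then by [v] with three. The bound for the enlarged set leaves room for the edge
    [pq]. *)
Lemma diamond_laman G v c p q : laman G ->
  (forall x, adj G v x = (x \in [set c; p; q])) ->
  adj G c p -> adj G c q -> p != q -> ~~ adj G p q ->
  laman (add_edge (remove G v) p q).
Proof.
move=> lG vN cp cq pq npq.
have vc : adj G v c by rewrite vN !inE eqxx.
have vp : adj G v p by rewrite vN !inE eqxx orbT.
have vq : adj G v q by rewrite vN !inE eqxx orbT.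
have c3 := cards3 (adj_neq cp) (adj_neq cq) pq.
apply: laman_move => //; first exact: adj_vertex vc.
  by rewrite (degreeE vN) c3.
move=> X vX pX qX.
have grow X' : v \notin X' -> c \in X' -> p \in X' -> q \in X' ->
    size_in G X' + 4 <= 2 * #|X'|.
  move=> vX' cX' pX' qX'.
  have h : size_in G X' + 3 <= size_in G (v |: X').
    rewrite -c3; apply: size_inU1_ge => // [|x]; last by rewrite vN.
    by apply/subsetP=> x; rewrite !inE => /orP[/orP[]|]/eqP->.
  have c1 : #|v |: X'| = #|X'|.+1 by rewrite cardsU1 vX'.
  have X1 : 0 < #|X'| by apply/card_gt0P; exists c.
  have := laman_sparse lG (X := v |: X'); rewrite c1 => /(_ X1) h'.
  by clear -h h'; lia.
case: (boolP (c \in X)) => cX; first exact: grow.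
have vX' : v \notin c |: X by rewrite !inE negb_or (adj_neq vc).
have h : size_in G X + 2 <= size_in G (c |: X).
  have <- : #|[set p; q]| = 2 by rewrite cards2 pq.
  apply: size_inU1_ge => // [|x]; last by rewrite !inE => /orP[]/eqP->.
  by apply/subsetP=> x; rewrite !inE => /orP[]/eqP->.
have := grow _ vX' (setU11 _ _) (setU1r _ pX) (setU1r _ qX).
rewrite cardsU1 cX => h'; clear -h h'; lia.
Qed.

(** Otherwise there are sets [X], containing [u] and [y], and [Y], containing [a] and [y], that
    attain the bound. Their union contains [u], [y] and [a], so attaching [w] and then [v] to it
    shows that it is one edge short of the bound. This contradicts supermodularity. *)
Lemma prism_side G v w u y a : laman G ->
  (forall x, adj G v x = (x \in [set u; w; y])) ->
  (forall x, adj G w x = (x \in [set v; y; a])) ->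
  u != y -> a != y -> u != w -> a != v -> adj G u a -> ~~ adj G u y ->
  (forall X, v \notin X -> u \in X -> y \in X -> size_in G X + 4 <= 2 * #|X|) \/
  (forall X, w \notin X -> a \in X -> y \in X -> size_in G X + 4 <= 2 * #|X|).
Proof.
move=> lG vN wN uy ay uw av ua nuy.
have vu : adj G v u by rewrite vN !inE eqxx.
have vw : adj G v w by rewrite vN !inE eqxx orbT.
have vy : adj G v y by rewrite vN !inE eqxx orbT.
have wa : adj G w a by rewrite wN !inE eqxx orbT.
have wy : adj G w y by rewrite wN !inE eqxx orbT.
have nN c X (A := neighbors G c) : c \notin X -> A \subset X -> degree G c = 3 ->
    size_in G X + 4 <= 2 * #|X|.
  move=> cX AX dc; have h := @size_inU1_ge G c X A cX AX.
  have {}h : size_in G X + 3 <= size_in G (c |: X).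
    by rewrite -dc; apply: h => x; rewrite inE.
  have c1 : #|c |: X| = #|X|.+1 by rewrite cardsU1 cX.
  have X1 : 0 < #|X|.
    by have := subset_leq_card AX; rewrite -/(degree G c) dc; case: #|X|.
  have := laman_sparse lG (X := c |: X); rewrite c1 => /(_ X1) h'.
  by clear -h h'; lia.
have dv : degree G v = 3 by rewrite (degreeE vN) cards3 ?(adj_neq wy).
have dw : degree G w = 3.
  by rewrite (degreeE wN) cards3 ?(adj_neq vy) // eq_sym.
have big X : v \notin X -> w \notin X -> u \in X -> y \in X -> a \in X ->
    size_in G X + 4 <= 2 * #|X|.
  move=> vX wX uX yX aX.
  have h : size_in G X + 2 <= size_in G (w |: X).
    have <- : #|[set y; a]| = 2 by rewrite cards2 eq_sym ay.
    apply: size_inU1_ge => // [|x]; last by rewrite !inE => /orP[]/eqP->.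
    by apply/subsetP=> x; rewrite !inE => /orP[]/eqP->.
  have c1 : #|w |: X| = #|X|.+1 by rewrite cardsU1 wX.
  have := nN v (w |: X); rewrite c1 !inE negb_or (adj_neq vw) => /(_ vX _ dv) h'.
  have {}h' : size_in G (w |: X) + 4 <= 2 * #|X|.+1.
    apply: h'; apply/subsetP=> x; rewrite in_neighbors vN !inE.
    by case/orP=> [/orP[]|] /eqP->; rewrite ?uX ?yX ?eqxx ?orbT.
  by clear -h h'; lia.
case: (classic (forall X, v \notin X -> u \in X -> y \in X ->
    size_in G X + 4 <= 2 * #|X|)) => [|nX]; [by left|right].
move=> Y wY aY yY; apply: contraT; rewrite -ltnNge => sY; case: nX.
move=> X vX uX yX; apply: contraT; rewrite -ltnNge => sX.
have wX : w \notin X.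
  apply: contraL sX => wX; rewrite -leqNgt; apply: (nN v) => //.
  apply/subsetP=> x; rewrite in_neighbors vN !inE.
  by case/orP=> [/orP[]|] /eqP->.
have vY : v \notin Y.
  apply: contraL sY => vY; rewrite -leqNgt; apply: (nN w) => //.
  apply/subsetP=> x; rewrite in_neighbors wN !inE.
  by case/orP=> [/orP[]|] /eqP->.
have aX : a \notin X by apply: contraL sX => aX; rewrite -leqNgt big.
have uY : u \notin Y by apply: contraL sY => uY; rewrite -leqNgt big.
have := big (X :|: Y); rewrite !inE !negb_or vX wX vY wY uX yX aY orbT.
move=> /(_ isT isT isT isT isT) sU.
have cU := cardsUI X Y.
have yI : y \in X :&: Y by rewrite inE yX.
have [I1|I1] := ltnP 1 #|X :&: Y|.
  have sI := laman_sparse lG I1; have sm := size_in_supermodular G X Y.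
  by clear -sX sY sU cU sI sm; lia.
have IE : X :&: Y = [set y].
  apply/esym/eqP; rewrite eqEcard sub1set yI cards1.
  exact: I1.
(* If [X] and [Y] meet only in [y], adding [u] to [Y] gains the edge [ua], while the intersection
   becomes the nonadjacent pair [u], [y], which has no edges. *)
have sm := size_in_supermodular G X (u |: Y).
have UE : X :|: (u |: Y) = X :|: Y.
  by rewrite setUCA; apply/setUidPr; rewrite sub1set inE uX.
have IE' : X :&: (u |: Y) = [set u; y].
  by rewrite setIUr IE; congr (_ :|: _); apply/setIidPr; rewrite sub1set.
have s0 : size_in G [set u; y] = 0.
  rewrite size_inU1 ?inE // size_in_le1 ?cards1 //; apply/eqP; rewrite cards_eq0.
  apply/eqP/setP=> x; rewrite !inE; case: eqP => [->|_]; last by rewrite andbF.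
  by rewrite (negPf nuy).
have sa : size_in G Y + 1 <= size_in G (u |: Y).
  rewrite -(cards1 a); apply: size_inU1_ge; rewrite ?sub1set //.
  by move=> x; rewrite inE => /eqP->.
rewrite UE IE' s0 in sm; rewrite IE cards1 in cU.
by clear -sX sY sU cU sm sa; lia.
Qed.

Lemma remove2_nac G v x y : (forall z, adj G v z = (z \in [set x; y])) ->
  adj G x y -> has_nac_coloring (remove G v) -> has_nac_coloring G.
Proof.
move=> vN xy nac.
have vx : adj G v x by rewrite vN set21.
have vy : adj G v y by rewrite vN set22.
have axy : adj (remove G v) x y.
  by rewrite adj_remove xy ![_ == v]eq_sym (adj_neq vx) (adj_neq vy).
apply: (extend_nac (v := v) (phi := id) nac axy) => [z t zt zv tv|z|z t zt _|].
- by rewrite adj_remove zt zv tv.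
- by rewrite vN !inE => /orP[]->; rewrite ?orbT.
- by move: zt; rewrite adj_remove => /and3P[].
- by exists x.
Qed.

Lemma remove2_triangle_connected G v x y :
  (forall z, adj G v z = (z \in [set x; y])) -> adj G x y ->
  triangle_connected (remove G v) -> triangle_connected G.
Proof.
move=> vN xy tK.
have vx : adj G v x by rewrite vN set21.
have vy : adj G v y by rewrite vN set22.
have axy : adj (remove G v) x y.
  by rewrite adj_remove xy ![_ == v]eq_sym (adj_neq vx) (adj_neq vy).
have tvxy : triangle G v x y by rewrite /triangle vx xy vy.
have [vx_xy vx_vy] := triangle_connect tvxy.
apply: (@triangle_connected_to _ _ [set x; y]) => e eG.
case ve: (v \in e).
  have [z -> ] := edge_at eG ve; rewrite vN !inE => /orP[]/eqP-> //.
  by apply: connect_trans vx_xy; rewrite (sym_connect_sym (@in_triangle_sym _ G)).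
have eK : e \in edges (remove G v).
  have [z [t [eE zt]]] := edge_adj eG; rewrite eE -/(adj _ z t) adj_remove zt.
  by move: ve; rewrite eE !inE ![_ == v]eq_sym => /norP[-> ->].
apply: connect_sub (tK _ _ eK axy) => e1 e2 /in_triangleP[z [t [s [ts h1 h2]]]].
apply/connect1/in_triangleP; exists z, t, s; split=> //.
by move: ts; rewrite /triangle !adj_remove => /and3P[/andP[-> _] /andP[-> _] /andP[-> _]].
Qed.

Lemma diamond_extend_nac G v c p q :
  (forall x, adj G v x = (x \in [set c; p; q])) ->
  adj G c p -> adj G c q -> p != q ->
  has_nac_coloring (add_edge (remove G v) p q) -> has_nac_coloring G.
Proof.
move=> vN cp cq pq nac.
have inK x : x != v -> adj G v x -> x \in vertices (remove G v).
  by move=> xv vx; rewrite !inE xv (adj_vertex (y := v)) // adj_sym.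
have vc : adj G v c by rewrite vN !inE eqxx.
have vp : adj G v p by rewrite vN !inE eqxx orbT.
have vq : adj G v q by rewrite vN !inE eqxx orbT.
have [cv pv qv] : [/\ c != v, p != v & q != v].
  by rewrite ![_ == v]eq_sym (adj_neq vc) (adj_neq vp) (adj_neq vq).
have Kadj x y : adj (add_edge (remove G v) p q) x y =
    [&& adj G x y, x != v & y != v] || ([set x; y] == [set p; q]).
  by rewrite adj_add_edge ?adj_remove ?inK.
have apq : adj (add_edge (remove G v) p q) p q by rewrite Kadj eqxx orbT.
apply: (extend_nac (v := v) (phi := id) nac apq) => [z t zt zv tv|z|z t zt n|].
- by rewrite Kadj zt zv tv.
- rewrite vN !inE !Kadj => /orP[/orP[]|] /eqP-> //; rewrite ?eqxx ?orbT //.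
  by rewrite cp cq cv pv qv !orbT.
- by move: zt; rewrite Kadj (negPf n) orbF => /and3P[].
- by exists p.
Qed.

End HennebergReductions.

(** * Adjacent vertices of degree three *)

Section PrismReduction.
Variable T : finType.
Implicit Types (G H K : graph T) (x y z u v w p q : T) (e : {set T}).
Implicit Types (X Y A : {set T}).

Lemma degree_other G x t : 2 <= degree G x -> exists2 y, adj G x y & y != t.
Proof.
rewrite /degree (cardsD1 t) => d.
have : 0 < #|neighbors G x :\ t|.
  rewrite -(ltn_add2l (t \in neighbors G x)); apply: leq_trans d.
  by case: (t \in _).
by case/card_gt0P=> y; rewrite !inE => /andP[yt xy]; exists y.
Qed.

(** The neighbors of [v] are pairwise nonadjacent, so the edges at [v] can form one color class; a
    neighbor of [v] has a second edge, which gets the other color. *)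
Lemma triangle_free_vertex_nac G v : laman G -> 2 < #|vertices G| ->
  v \in vertices G -> (forall x y, ~~ triangle G v x y) -> has_nac_coloring G.
Proof.
move=> lG G2 vG free.
have nbr x t : x \in vertices G -> exists2 y, adj G x y & y != t.
  by move=> xG; apply/degree_other/laman_degree.
have [y0 vy _] := nbr v v vG.
have y0G : y0 \in vertices G by apply: (adj_vertex (y := v)); rewrite adj_sym.
have [z yz zv] := nbr y0 v y0G.
apply: (@cut_nac _ _ [set v]) => [x y xy _ _ [a] + + [b]||].
- rewrite !inE => /eqP-> vx /eqP-> vy'.
  by have := free x y; rewrite /triangle vx xy vy'.
- by exists v, y0; rewrite set11.
- by exists y0, z; rewrite !inE zv eq_sym (adj_neq vy).
Qed.

Section Prism.
Variables (G : graph T) (v w u y a : T).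
Hypotheses (lG : laman G)
  (vN : forall x, adj G v x = (x \in [set u; w; y]))
  (wN : forall x, adj G w x = (x \in [set v; y; a]))
  (uy : u != y) (ay : a != y) (uw : u != w) (av : a != v)
  (nuy : ~~ adj G u y) (nay : ~~ adj G a y).

Let vu : adj G v u. Proof. by rewrite vN !inE eqxx. Qed.
Let vw : adj G v w. Proof. by rewrite vN !inE eqxx orbT. Qed.
Let vy : adj G v y. Proof. by rewrite vN !inE eqxx orbT. Qed.
Let wa : adj G w a. Proof. by rewrite wN !inE eqxx orbT. Qed.
Let wy : adj G w y. Proof. by rewrite wN !inE eqxx orbT. Qed.

(** The neighbors [u], [y], [a] of the set formed by [v] and [w] are pairwise nonadjacent, so the
    edges meeting this set can form one color class. A second edge at [u] has the other color. *)
Lemma prism_nonadjacent_nac : u != a -> ~~ adj G u a -> 2 <= degree G u ->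
  has_nac_coloring G.
Proof.
move=> ua nua du.
have uv : u != v by rewrite eq_sym (adj_neq vu).
have [z uz zv] := degree_other v du.
have zw : z != w.
  apply: contraTneq uz => ->; rewrite adj_sym wN !inE !negb_or.
  by rewrite uv uy ua.
have near x b : b \in [set v; w] -> adj G b x -> x \notin [set v; w] ->
    x \in [set u; y; a].
  move=> bA bx; rewrite !inE => /norP[/negPf xv /negPf xw]; move: bA bx.
  rewrite !inE => /orP[]/eqP->; rewrite ?vN ?wN !inE ?xv ?xw ?orbF /=.
    by case/orP=> ->; rewrite ?orbT.
  by case/orP=> ->; rewrite !orbT.
apply: (@cut_nac _ _ [set v; w]) => [x t xt xA tA [b bA bx] [b' bA' bt]||].
- have := near x b bA bx xA; have := near t b' bA' bt tA.
  have [nyu nya nau] : [/\ ~~ adj G y u, ~~ adj G y a & ~~ adj G a u].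
    by rewrite ![adj G y _]adj_sym [adj G a u]adj_sym.
  rewrite !inE => /orP[/orP[]|] /eqP tE /orP[/orP[]|] /eqP xE; move: xt;
  by rewrite xE tE ?adj_irr ?(negPf nuy) ?(negPf nay) ?(negPf nua) ?(negPf nyu)
    ?(negPf nya) ?(negPf nau).
- by exists v, w; rewrite set21.
- by exists u, z; rewrite !inE !negb_or uv uw zv zw.
Qed.

(** The intermediate graph: an inverse move of type II at [v] leaves [w] with the two neighbors [y]
    and [a], so [w] is then removed by an inverse move of type I. *)
Let K := add_edge (remove G v) u y.

Let uv : u != v. Proof. by rewrite eq_sym (adj_neq vu). Qed.
Let wv : w != v. Proof. by rewrite eq_sym (adj_neq vw). Qed.
Let yv : y != v. Proof. by rewrite eq_sym (adj_neq vy). Qed.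
Let yw : y != w. Proof. by rewrite eq_sym (adj_neq wy). Qed.
Let aw : a != w. Proof. by rewrite eq_sym (adj_neq wa). Qed.

Let Kadj x z : adj K x z =
  [&& adj G x z, x != v & z != v] || ([set x; z] == [set u; y]).
Proof.
have inK t : t != v -> adj G v t -> t \in vertices (remove G v).
  by move=> tv vt; rewrite !inE tv (adj_vertex (y := v)) // adj_sym.
by rewrite adj_add_edge ?adj_remove ?inK.
Qed.

Let KN x : adj K w x = (x \in [set y; a]).
Proof.
rewrite Kadj wN wv !inE eq_set2 ![w == _]eq_sym (negPf uw) (negPf yw) !orbF /=.
have [->|xv] := eqVneq x v; last by rewrite andbT.
by rewrite andbF ![v == _]eq_sym (negPf yv) (negPf av).
Qed.

Let K1adj x z : adj (remove K w) x z =
  [&& adj G x z, x \notin [set v; w] & z \notin [set v; w]]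
    || ([set x; z] == [set u; y]).
Proof.
rewrite adj_remove Kadj !inE !negb_or; case: ([set x; z] =P [set u; y]) => [E|_].
  move/eqP: E; rewrite eq_set2 !orbT /=.
  by case/orP=> /andP[/eqP-> /eqP->]; rewrite uw yw.
by rewrite !orbF; case: (adj G x z) => //=; case: (x != v); case: (x != w);
  rewrite ?andbF.
Qed.

Lemma prism_triangle_connected_nac : adj G u a -> laman (remove K w) ->
  triangle_connected (remove K w) -> has_nac_coloring G.
Proof. by move=> ua; exact: (prism_nac vN wN ua nay nuy uw av ay K1adj). Qed.

Lemma prism_extend_nac : adj G u a -> has_nac_coloring (remove K w) ->
  has_nac_coloring G.
Proof.
move=> ua nac; have auy : adj (remove K w) u y by rewrite K1adj eqxx orbT.
have aua : adj (remove K w) u a.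
  by rewrite K1adj ua !inE !negb_or uv uw av aw.
(* The vertex [w] is put at the point of [u]: its neighbors [y] and [a] are adjacent to [u] in
   [remove K w]. Then [v] goes on the line through [u] and [y]. *)
pose phi x := if x == w then u else x.
have phiw : phi w = u by rewrite /phi eqxx.
have phin x : x != w -> phi x = x by rewrite /phi => /negPf->.
have wphi z : adj G w z -> z != v -> adj (remove K w) u (phi z).
  rewrite wN !inE => zN zv; move: zN; rewrite (negPf zv) /=.
  by case/orP=> /eqP->; rewrite phin.
apply: (extend_nac (v := v) (phi := phi) nac auy) => [x z xz xv zv|x|x z xz n|].
- have [xw|xw] := eqVneq x w; first by subst x; rewrite phiw; exact: wphi.
  have [zw|zw] := eqVneq z w.
    by subst z; rewrite phiw adj_sym; apply: wphi; rewrite // adj_sym.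
  by rewrite !phin // K1adj xz !inE !negb_or xv xw zv zw.
- rewrite vN !inE => /orP[/orP[]|] /eqP->; rewrite ?phiw ?phin ?eqxx ?orbT //.
- move: xz; rewrite K1adj (negPf n) orbF !inE !negb_or.
  by case/and3P=> xz /andP[xv xw] /andP[zv zw]; rewrite !phin.
- by exists w.
Qed.

Lemma prism_laman :
  (forall X, v \notin X -> u \in X -> y \in X -> size_in G X + 4 <= 2 * #|X|) ->
  laman K /\ laman (remove K w).
Proof.
move=> s; have lK : laman K.
  apply: laman_move => //; first exact: adj_vertex vw.
  by rewrite (degreeE vN) cards3 ?(adj_neq wy).
split=> //; apply: laman_remove2 => //.
  by apply: (adj_vertex (y := y)); rewrite KN set21.
by rewrite (degreeE KN) cards2 eq_sym ay.
Qed.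

Lemma prism_henneberg :
  henneberg1 (remove K w) K /\ henneberg2 K G.
Proof.
split; first by apply: (remove_henneberg1 KN); rewrite eq_sym.
apply: (@move_henneberg2 _ G v w u y) => //; last exact: (adj_neq wy).
  by move=> x; rewrite vN [[set w; u]]setUC.
by rewrite eq_sym.
Qed.

End Prism.

Definition nac_or_problematic G : Prop :=
  has_nac_coloring G \/
  exists Gt : graph T,
    [/\ problematic Gt, ~ has_nac_coloring Gt & henneberg_constructible Gt G].

Lemma nac_or_problematic_step K G :
  (has_nac_coloring K -> has_nac_coloring G) ->
  (forall Gt, henneberg_constructible Gt K -> henneberg_constructible Gt G) ->
  nac_or_problematic K -> nac_or_problematic G.
Proof.
move=> nKG cKG [/nKG|[Gt [pGt nGt /cKG cGt]]]; first by left.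
by right; exists Gt.
Qed.

Lemma not_triangle_connected_card G : laman G -> ~ triangle_connected G ->
  2 < #|vertices G|.
Proof.
move=> [cE _] nt; rewrite ltnNge; apply/negP=> V2; apply: nt => e1 e2 e1G e2G.
have E1 : #|edges G| <= 1 by move: cE V2; lia.
by have /card_le1_eqP/(_ _ _ e1G e2G)-> := E1.
Qed.

End PrismReduction.

(** * The induction *)

Section Induction.
Variable T : finType.
Implicit Types (G H K : graph T) (x y z u v w p q : T) (e : {set T}).
Implicit Types (X Y A : {set T}).

Lemma set3_third A x y : #|A| = 3 -> x \in A -> y \in A -> x != y ->
  exists z, [/\ z != x, z != y & A = [set x; y; z]].
Proof.
move=> A3 xA yA xy; have yAx : y \in A :\ x by rewrite !inE eq_sym xy.
have /eqP/cards1P[z Az] : #|(A :\ x) :\ y| = 1.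
  by move: A3; rewrite (cardsD1 x) xA (cardsD1 y) yAx !add1n => -[].
have : z \in (A :\ x) :\ y by rewrite Az set11.
rewrite !inE => /and3P[zy zx _]; exists z; split=> //.
by rewrite -(setD1K xA) -(setD1K yAx) Az setUA.
Qed.

Lemma card_remove G v : v \in vertices G ->
  #|vertices (remove G v)| < #|vertices G|.
Proof. by move=> vG; rewrite [X in _ < X](cardsD1 v) vG. Qed.

Lemma laman_nac_or_problematic G : laman G -> ~ triangle_connected G ->
  nac_or_problematic G.
Proof.
have [n] := ubnP #|vertices G|; elim: n G => // n IH G Gn lG nt.
have V3 := not_triangle_connected_card lG nt.
apply: NNPP => ng; have nn : ~ has_nac_coloring G by move=> h; apply: ng; left.
(* For a counterexample [G] no reduction exists: either the smaller graph is triangle-connected and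
   [G] gets a coloring directly, or the induction hypothesis transfers to [G]. *)
have reduce K : #|vertices K| < #|vertices G| -> laman K ->
    (triangle_connected K -> has_nac_coloring G) ->
    (has_nac_coloring K -> has_nac_coloring G) ->
    (forall Gt, henneberg_constructible Gt K -> henneberg_constructible Gt G) ->
    False.
  move=> KG lK tKG nKG cKG; apply/ng/(nac_or_problematic_step nKG cKG)/IH => //.
    by apply: leq_trans KG _.
  by move/tKG.
have tri v : v \in vertices G -> exists x y, triangle G v x y.
  move=> vG; apply: NNPP => no; apply: nn.
  apply: (triangle_free_vertex_nac lG V3 vG) => x y.
  by apply/negP=> t; apply: no; exists x, y.
have deg3 v : v \in vertices G -> 3 <= degree G v.
  move=> vG; rewrite leqNgt; apply/negP=> d2.
  have [x [y /and3P[vx xy vy]]] := tri v vG.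
  have NE : [set x; y] = neighbors G v.
    apply/eqP; rewrite eqEcard cards2 (adj_neq xy) -/(degree G v) -ltnS d2 andbT.
    by apply/subsetP=> z; rewrite !inE => /orP[]/eqP->.
  have vN z : adj G v z = (z \in [set x; y]) by rewrite NE inE.
  have dv : degree G v = 2 by rewrite (degreeE vN) cards2 (adj_neq xy).
  apply: (@reduce (remove G v)).
  - exact: card_remove.
  - exact: laman_remove2.
  - by move/(remove2_triangle_connected vN xy)/nt.
  - exact: remove2_nac vN xy.
  - move=> Gt c; apply: Henneberg_rcons c _ lG; left.
    exact: remove_henneberg1 vN (adj_neq xy).
have diamond v c p q : (forall x, adj G v x = (x \in [set c; p; q])) ->
    adj G c p -> adj G c q -> p != q -> False.
  move=> vN cp cq pq.
  have vc : adj G v c by rewrite vN !inE eqxx.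
  have npq : ~~ adj G p q.
    by apply: (laman_K4_free lG vc _ _ cp cq); rewrite vN !inE eqxx !orbT.
  have lK := diamond_laman lG vN cp cq pq npq.
  apply: (@reduce (add_edge (remove G v) p q)) => //.
  - by apply: card_remove; apply: adj_vertex vc.
  - by move=> tK; apply: (diamond_nac vN cp cq pq npq lK tK nt).
  - exact: diamond_extend_nac vN cp cq pq.
  - move=> Gt c'; apply: Henneberg_rcons c' _ lG; right.
    exact: (move_henneberg2 vN (adj_neq cp) (adj_neq cq) pq npq).
have prism1 v w u y a : (forall x, adj G v x = (x \in [set u; w; y])) ->
    (forall x, adj G w x = (x \in [set v; y; a])) ->
    u != y -> a != y -> u != w -> a != v -> ~~ adj G u y -> ~~ adj G a y ->
    adj G u a ->
    (forall X, v \notin X -> u \in X -> y \in X -> size_in G X + 4 <= 2 * #|X|) ->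
    False.
  move=> vN wN uy ay uw av nuy nay ua s.
  have [lK lK1] := prism_laman lG vN wN uy ay uw av nuy s.
  have [h1 h2] := prism_henneberg vN wN uy ay uw av nuy.
  apply: (reduce _ _ lK1).
  - have vG : v \in vertices G by apply: (adj_vertex (y := u)); rewrite vN !inE eqxx.
    apply: leq_ltn_trans (card_remove vG); apply: subset_leq_card.
    exact: subsetDl.
  - exact: (prism_triangle_connected_nac vN wN uy ay uw av nuy nay ua).
  - exact: (prism_extend_nac vN wN uy uw av ua).
  - move=> Gt c; apply: Henneberg_rcons (or_intror h2) lG.
    exact: Henneberg_rcons c (or_introl h1) lK.
have prism v w u y a : (forall x, adj G v x = (x \in [set u; w; y])) ->
    (forall x, adj G w x = (x \in [set v; y; a])) ->
    u != y -> a != y -> u != w -> a != v -> u != a ->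
    ~~ adj G u y -> ~~ adj G a y -> False.
  move=> vN wN uy ay uw av ua nuy nay.
  have uG : u \in vertices G.
    by apply: (adj_vertex (y := v)); rewrite adj_sym vN !inE eqxx.
  case: (boolP (adj G u a)) => [aua|nua]; last first.
    by apply/nn/(prism_nonadjacent_nac vN wN uy uw nuy nay ua nua)/ltnW/deg3.
  have [s|s] := prism_side lG vN wN uy ay uw av aua nuy.
    exact: (prism1 v w u y a).
  (* The second alternative is the first one in the mirror image that exchanges [v] with [w] and [u]
     with [a]. *)
  apply: (prism1 w v a y u) => //.
  - by move=> x; rewrite wN !inE; do 3 case: (x == _).
  - by move=> x; rewrite vN !inE; do 3 case: (x == _).
  - by rewrite adj_sym.
have deg4 v x y z : (forall t, adj G v t = (t \in [set x; y; z])) ->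
    adj G x y -> ~~ adj G x z -> ~~ adj G y z -> z != x -> z != y ->
    4 <= degree G x.
  move=> vN xy nxz nyz zx zy.
  have [vx vy] : adj G v x /\ adj G v y by rewrite !vN !inE !eqxx orbT.
  rewrite ltn_neqAle deg3 ?(adj_vertex xy) // andbT; apply/negP=> /eqP dx.
  have [||a [av ay NE]] := @set3_third (neighbors G x) v y (esym dx) _ _ (adj_neq vy).
  - by rewrite inE adj_sym.
  - by rewrite inE.
  have xN t : adj G x t = (t \in [set v; y; a]) by rewrite -NE inE.
  (* If [a] is adjacent to [y], then [x] has degree three and its neighbors [v] and [a] are both
     adjacent to its neighbor [y], which [diamond] excludes. Otherwise [v] and [x] are adjacent
     vertices of degree three with the common neighbor [y], as in [prism]. *)
  case: (boolP (adj G a y)) => ay'.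
    apply: (@diamond x y v a); rewrite 1?adj_sym //; last by rewrite eq_sym.
    by move=> t; rewrite xN [[set v; y]]setUC.
  apply: (prism v x z y a) => //; last by rewrite adj_sym.
    by move=> t; rewrite vN !inE; do 3 case: (t == _).
  by apply: contraNneq nxz => ->; rewrite xN !inE eqxx !orbT.
(* All reductions being excluded, [G] itself is problematic, with the empty sequence of moves. *)
apply: ng; right; exists G; split=> //; last exact: Henneberg_nil.
split=> // v vG dv.
have [x [y /and3P[vx xy vy]]] := tri v vG.
have [||z [zx zy NE]] := @set3_third (neighbors G v) x y dv _ _ (adj_neq xy).
- by rewrite inE.
- by rewrite inE.
have vN t : adj G v t = (t \in [set x; y; z]) by rewrite -NE inE.
have yx : adj G y x by rewrite adj_sym.
have vN' t : adj G v t = (t \in [set y; x; z]) by rewrite vN [[set x; y]]setUC.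
have nxz : ~~ adj G x z by apply/negP=> xz; apply: (diamond _ _ _ _ vN xy xz); rewrite eq_sym.
have nyz : ~~ adj G y z by apply/negP=> yz; apply: (diamond _ _ _ _ vN' yx yz); rewrite eq_sym.
exists x, y; split; [|exact: deg4 vN xy nxz nyz zx zy|exact: deg4 vN' yx nyz nxz zy zx].
have nzx : ~~ adj G z x by rewrite adj_sym.
have nzy : ~~ adj G z y by rewrite adj_sym.
apply/setP=> e; rewrite in_set1 inE; apply/andP/eqP => [[eG]|->]; last first.
  by split=> //; rewrite NE subsetUl.
have [s [t [-> st]]] := edge_adj eG; rewrite NE => /subsetP sub; move: st.
have := sub s (set21 s t); have := sub t (set22 s t).
rewrite !inE => /orP[/orP[]|] /eqP-> /orP[/orP[]|] /eqP-> //.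
all: by rewrite ?adj_irr ?(negPf nxz) ?(negPf nyz) ?(negPf nzx) ?(negPf nzy) // setUC.
Qed.

End Induction.

Theorem theorem6 (T : finType) (G : graph T) :
  laman G ->
  ~ triangle_connected G ->
  has_nac_coloring G \/
  exists Gt : graph T,
    [/\ problematic Gt, ~ has_nac_coloring Gt & henneberg_constructible Gt G].
Proof. exact: laman_nac_or_problematic. Qed.
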